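(* ML-VDISJ-PATH with $p$ source-sink pairs is polynomially reducible to ML-CAP-STEINER-TREE with $p(p+1)/2$ terminals. (This holds for undirected graphs, and likewise for directed graphs.)
   Context: Graphs $G=(V,E)$ are finite and may be directed or undirected; ''path'' means directed path in the directed case. ML-CAP-STEINER-TREE. Input: a connected graph $G=(V,E)$; a set $T\subset V$ of $K\ge 1$ terminals; a root $r\in V\setminus T$ (if $G$ is directed, there is a directed path from $r$ to every vertex of $V$); a nonnegative rational length $\ell(e)$ and a positive integer capacity $c(e)$ for every $e\in E$. Objective: determine, if one exists, a tree $S$ in $G$, directed away from its root $r$, that spans all vertices of $T$ (it need not span $V$), satisfies the capacity constraints, and has minimum total length. The capacity constraints say: for every arc $e=(u,v)$ of $S$, the subtree of $S$ rooted at $v$ contains at most $c(e)$ terminals. If $G$ is undirected, an arc $(u,v)$ of $S$ must be such that $[u,v]\in E$, and it has the length and capacity of that edge. ML-VDISJ-PATH. Input: a graph $G=(V,E)$; a nonnegative length function $\ell$ on $E$; $p$ disjoint vertex pairs (source-sink pairs) $(s_1,s'_1),\dots,(s_p,s'_p)$. Objective: find, if they exist, $p$ mutually vertex-disjoint paths $\mu_1,\dots,\mu_p$ of minimum total length such that $\mu_i$ links $s_i$ to $s'_i$ for $i=1,\dots,p$. ''Polynomially reducible'' here means: there is a polynomial-time transformation of instances $I$ of the first problem into instances $I'$ of the second (of the indicated form) such that $I$ is feasible if and only if $I'$ is, and any optimal solution of $I'$ can be converted in polynomial time into an optimal solution of $I$.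
   Formalization: Infeasible instances with a single source-sink pair (p = 1) are excluded, because a one-terminal ML-CAP-STEINER-TREE instance is always feasible (the root reaches the terminal and capacities are at least 1), so feasibility could not be equivalent for them. *)

(* Defs.v *)
From mathcomp Require Import all_boot all_order all_algebra.

Set Implicit Arguments.
Unset Strict Implicit.
Unset Printing Implicit Defensive.

Import Order.TTheory GRing.Theory Num.Theory.

(* Polynomial time is measured on an imperative WHILE language over binary    *)
(* trees, in the style of N. D. Jones, "Computability and Complexity".        *)

Inductive tree : Type := Leaf | Node of tree & tree.

Fixpoint tsize (v : tree) : nat :=
  if v is Node v1 v2 then (tsize v1 + tsize v2).+1 else 1.

Definition thead (v : tree) : tree := if v is Node v1 _ then v1 else Leaf.
Definition ttail (v : tree) : tree := if v is Node _ v2 then v2 else Leaf.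
Definition nonleaf (v : tree) : bool := if v is Node _ _ then true else false.

Definition store := nat -> tree.

Definition upd (s : store) (x : nat) (v : tree) : store :=
  fun y => if y == x then v else s y.

(* The argument of a program is in variable 0, and so is its result.          *)
Definition init (v : tree) : store := upd (fun _ => Leaf) 0 v.

Inductive expr : Type :=
  | Var of nat
  | Nil
  | Cons of expr & expr
  | Hd of expr
  | Tl of expr.

Fixpoint eval (s : store) (e : expr) : tree :=
  match e with
  | Var x => s x
  | Nil => Leaf
  | Cons e1 e2 => Node (eval s e1) (eval s e2)
  | Hd e1 => thead (eval s e1)
  | Tl e1 => ttail (eval s e1)
  end.

Inductive cmd : Type :=
  | Skip
  | Assign of nat & expr
  | Seq of cmd & cmd
  | If of expr & cmd & cmd
  | While of expr & cmd
  | Call of nat & cmd & expr.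

(* [exec c s s' t]: from store [s], [c] halts in store [s'] after time [t].   *)
(* [Call x c e] runs [c] as a procedure with its own local variables.         *)
(* Every tree that is stored is charged its full size: trees are considered   *)
(* as copied, not shared, so time bounds the size of all stored data up to    *)
(* the size of the input, and polynomial time is that of Turing machines.     *)
Inductive exec : cmd -> store -> store -> nat -> Prop :=
  | ExecSkip s : exec Skip s s 1
  | ExecAssign s x e :
      exec (Assign x e) s (upd s x (eval s e)) (tsize (eval s e)).+1
  | ExecSeq c1 c2 s1 s2 s3 t1 t2 :
      exec c1 s1 s2 t1 -> exec c2 s2 s3 t2 ->
      exec (Seq c1 c2) s1 s3 (t1 + t2)
  | ExecIfTrue e c1 c2 s s' t :
      nonleaf (eval s e) -> exec c1 s s' t -> exec (If e c1 c2) s s' t.+1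
  | ExecIfFalse e c1 c2 s s' t :
      ~~ nonleaf (eval s e) -> exec c2 s s' t -> exec (If e c1 c2) s s' t.+1
  | ExecWhileTrue e c s1 s2 s3 t1 t2 :
      nonleaf (eval s1 e) -> exec c s1 s2 t1 -> exec (While e c) s2 s3 t2 ->
      exec (While e c) s1 s3 (t1 + t2).+1
  | ExecWhileFalse e c s :
      ~~ nonleaf (eval s e) -> exec (While e c) s s 1
  | ExecCall x c e s s' t :
      exec c (init (eval s e)) s' t ->
      exec (Call x c e) s (upd s x (s' 0))
           (tsize (eval s e) + t + tsize (s' 0)).+1.

Definition runs (c : cmd) (v w : tree) (t : nat) : Prop :=
  exists s' : store, exec c (init v) s' t /\ s' 0 = w.

Definition runs_poly (k : nat) (c : cmd) (v w : tree) : Prop :=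
  exists2 t : nat, runs c v w t & t <= tsize v ^ k + k.

Definition enc_unary (n : nat) : tree := iter n (Node Leaf) Leaf.

(* Binary digits, least significant first, the leading 1 being implicit.      *)
Fixpoint enc_pos (b : BinNums.positive) : tree :=
  match b with
  | BinNums.xH => Leaf
  | BinNums.xO b' => Node Leaf (enc_pos b')
  | BinNums.xI b' => Node (Node Leaf Leaf) (enc_pos b')
  end.

Definition enc_binary (n : nat) : tree :=
  if bin_of_nat n is BinNums.Npos b then Node Leaf (enc_pos b) else Leaf.

Definition enc_bool (b : bool) : tree := if b then Node Leaf Leaf else Leaf.

Definition enc_int (z : int) : tree :=
  Node (enc_bool (z < 0)%R) (enc_binary `|z|%N).

Definition enc_rat (q : rat) : tree := Node (enc_int (numq q)) (enc_int (denq q)).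

Definition enc_opt (X : Type) (enc : X -> tree) (o : option X) : tree :=
  if o is Some x then Node Leaf (enc x) else Leaf.

Definition enc_pair (X Y : Type) (encX : X -> tree) (encY : Y -> tree)
    (u : X * Y) : tree := Node (encX u.1) (encY u.2).

Definition enc_seq (X : Type) (enc : X -> tree) (s : seq X) : tree :=
  foldr (fun x v => Node (enc x) v) Leaf s.

(* Vertices are numbered from 0 and written in unary, which costs at most the *)
(* number of vertices; lengths and capacities are written in binary.          *)
Definition enc_vertex (n : nat) (x : 'I_n) : tree := enc_unary x.

(* A weighted graph is given by its adjacency matrix, row by row.             *)
Definition enc_graph (n : nat) (W : Type) (encW : W -> tree)
    (e : rel 'I_n) (w : 'I_n -> 'I_n -> W) : tree :=
  enc_seq (enc_seq (enc_opt encW))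
    [seq [seq if e x y then Some (w x y) else None | y <- enum 'I_n]
       | x <- enum 'I_n].

Record problem : Type := Problem {
  inst : Type;
  sol : inst -> Type;
  enc_inst : inst -> tree;
  enc_sol : forall I : inst, sol I -> tree;
  is_inst : inst -> Prop;
  is_sol : forall I : inst, sol I -> Prop;
  cost : forall I : inst, sol I -> rat }.

Arguments enc_inst : clear implicits.
Arguments is_inst : clear implicits.
Arguments enc_sol P {I} : rename.
Arguments is_sol P {I} : rename.
Arguments cost P {I} : rename.

Definition feasible (P : problem) (I : inst P) : Prop :=
  exists S : sol I, is_sol P S.

Definition optimal (P : problem) (I : inst P) (S : sol I) : Prop :=
  is_sol P S /\ forall S' : sol I, is_sol P S' -> (cost P S <= cost P S')%R.

Definition restrict (P : problem) (D : inst P -> Prop) : problem :=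
  Problem (enc_inst P) (@enc_sol P) (fun I => is_inst P I /\ D I)
          (@is_sol P) (@cost P).

(* [F] transforms instances, [G] converts optimal solutions back, and [form]  *)
(* is the form required of the instances produced by [F].                     *)
Definition poly_reducible (P Q : problem) (form : inst P -> inst Q -> Prop) :
    Prop :=
  exists (F G : cmd) (k : nat), forall I : inst P, is_inst P I ->
  exists I' : inst Q,
    [/\ is_inst Q I',
        form I I',
        runs_poly k F (enc_inst P I) (enc_inst Q I'),
        feasible I <-> feasible I' &
        forall S' : sol I', optimal S' ->
        exists2 S : sol I, optimal S &
          runs_poly k G (Node (enc_inst P I) (enc_sol Q S')) (enc_sol P S)].

(* Graphs are loopless and have no parallel edges. A graph on ['I_n] is its   *)
(* adjacency relation, [e x y] standing for the arc (x, y) or the edge [x, y];*)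
(* an undirected graph is a symmetric one. Weights matter on edges only.      *)
Definition is_graph (directed : bool) (n : nat) (e : rel 'I_n) : Prop :=
  irreflexive e /\ (~~ directed -> symmetric e).

Definition is_weight (directed : bool) (n : nat) (e : rel 'I_n)
    (W : Type) (w : 'I_n -> 'I_n -> W) : Prop :=
  ~~ directed -> forall x y : 'I_n, e x y -> w x y = w y x.

Record vdp_inst : Type := VdpInst {
  vdp_n : nat;
  vdp_edge : rel 'I_vdp_n;
  vdp_len : 'I_vdp_n -> 'I_vdp_n -> rat;
  vdp_pairs : seq ('I_vdp_n * 'I_vdp_n) }.

Definition vdp_sol (I : vdp_inst) : Type := seq (seq 'I_(vdp_n I)).

Definition vdp_enc_inst (I : vdp_inst) : tree :=
  Node (enc_graph enc_rat (@vdp_edge I) (@vdp_len I))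
       (enc_seq (enc_pair (@enc_vertex _) (@enc_vertex _)) (vdp_pairs I)).

Definition vdp_enc_sol (I : vdp_inst) (mu : vdp_sol I) : tree :=
  enc_seq (enc_seq (@enc_vertex _)) mu.

Definition vdp_is_inst (directed : bool) (I : vdp_inst) : Prop :=
  [/\ is_graph directed (@vdp_edge I),
      is_weight directed (@vdp_edge I) (@vdp_len I),
      forall x y, vdp_edge x y -> (0 <= @vdp_len I x y)%R,
      0 < size (vdp_pairs I) &
      uniq (unzip1 (vdp_pairs I) ++ unzip2 (vdp_pairs I))].

Definition path_links (n : nat) (e : rel 'I_n) (st : 'I_n * 'I_n)
    (m : seq 'I_n) : bool :=
  if m is x :: q then [&& x == st.1, last x q == st.2, path e x q & uniq m]
  else false.

Definition vdp_is_sol (I : vdp_inst) (mu : vdp_sol I) : Prop :=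
  all2 (path_links (@vdp_edge I)) (vdp_pairs I) mu /\
  pairwise (fun m m' : seq 'I_(vdp_n I) => ~~ has (mem m) m') mu.

Definition path_length (n : nat) (w : 'I_n -> 'I_n -> rat) (m : seq 'I_n) : rat :=
  (\sum_(a <- zip m (behead m)) w a.1 a.2)%R.

Definition vdp_cost (I : vdp_inst) (mu : vdp_sol I) : rat :=
  (\sum_(m <- mu) path_length (@vdp_len I) m)%R.

Definition ML_VDISJ_PATH (directed : bool) : problem :=
  Problem vdp_enc_inst vdp_enc_sol (vdp_is_inst directed) vdp_is_sol vdp_cost.

Record cst_inst : Type := CstInst {
  cst_n : nat;
  cst_edge : rel 'I_cst_n;
  cst_len : 'I_cst_n -> 'I_cst_n -> rat;
  cst_cap : 'I_cst_n -> 'I_cst_n -> nat;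
  cst_root : 'I_cst_n;
  cst_term : {set 'I_cst_n} }.

(* The set of arcs of the tree, oriented away from the root.                  *)
Definition cst_sol (I : cst_inst) : Type := {set 'I_(cst_n I) * 'I_(cst_n I)}.

Definition cst_enc_inst (I : cst_inst) : tree :=
  Node (enc_graph (enc_pair enc_rat enc_binary) (@cst_edge I)
          (fun x y => (@cst_len I x y, @cst_cap I x y)))
       (Node (enc_vertex (cst_root I))
             (enc_seq (@enc_vertex _) (enum (cst_term I)))).

Definition cst_enc_sol (I : cst_inst) (S : cst_sol I) : tree :=
  enc_seq (enc_pair (@enc_vertex _) (@enc_vertex _)) (enum S).

Definition cst_is_inst (directed : bool) (I : cst_inst) : Prop :=
  [/\ [/\ is_graph directed (@cst_edge I),
          is_weight directed (@cst_edge I) (@cst_len I) &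
          is_weight directed (@cst_edge I) (@cst_cap I)],
      if directed then forall x, connect (@cst_edge I) (cst_root I) x
      else forall x y, connect (@cst_edge I) x y,
      forall x y, cst_edge x y -> (0 <= @cst_len I x y)%R,
      forall x y, cst_edge x y -> 0 < @cst_cap I x y &
      0 < #|cst_term I| /\ cst_root I \notin cst_term I].

Definition arc_rel (n : nat) (S : {set 'I_n * 'I_n}) : rel 'I_n :=
  fun x y => (x, y) \in S.

Definition tree_vertices (n : nat) (r : 'I_n) (S : {set 'I_n * 'I_n}) :
    {set 'I_n} :=
  r |: [set a.1 | a in S] :|: [set a.2 | a in S].

Definition is_arborescence (n : nat) (r : 'I_n) (S : {set 'I_n * 'I_n}) : Prop :=
  [/\ forall a, a \in S -> a.2 != r,
      forall a b, a \in S -> b \in S -> a.2 = b.2 -> a = b &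
      forall x, x \in tree_vertices r S -> connect (arc_rel S) r x].

Definition subtree (n : nat) (S : {set 'I_n * 'I_n}) (v : 'I_n) : {set 'I_n} :=
  [set x | connect (arc_rel S) v x].

Definition cst_is_sol (I : cst_inst) (S : cst_sol I) : Prop :=
  [/\ forall a, a \in S -> cst_edge a.1 a.2,
      is_arborescence (cst_root I) S,
      cst_term I \subset tree_vertices (cst_root I) S &
      forall a, a \in S -> #|cst_term I :&: subtree S a.2| <= @cst_cap I a.1 a.2].

Definition cst_cost (I : cst_inst) (S : cst_sol I) : rat :=
  (\sum_(a in S) @cst_len I a.1 a.2)%R.

Definition ML_CAP_STEINER_TREE (directed : bool) : problem :=
  Problem cst_enc_inst cst_enc_sol (cst_is_inst directed) cst_is_sol cst_cost.

(* With a single pair, the target instance has a single terminal, which the   *)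
(* root always reaches, and every capacity is at least 1: the target is       *)
(* always feasible. So no transformation preserves infeasibility, and         *)
(* infeasible instances with one pair must be left out.                       *)
Definition feasible_if_single_pair (directed : bool)
    (I : inst (ML_VDISJ_PATH directed)) : Prop :=
  size (vdp_pairs I) = 1 -> feasible I.

(* Main.v *)
(* Add a root r joined to s_i by an edge of capacity i, and hang i terminals
   on s'_i. Every terminal below s'_i is in the subtree of s'_i, so a subtree
   through (r, s_i) that contains s'_j has at least j terminals, whence j <= i;
   by descending induction on j it is s_j that leads to s'_j, for all j. The
   subtrees at the s_j are disjoint, and so are the paths that they contain.

   The target must be connected, so s'_p is joined to every vertex by an edge
   of capacity 1 and of length M larger than any solution of the path problem.
   Such an edge cannot enter s'_p: if p > 1 its capacity forbids it, and if
   p = 1 its length does, since an optimal tree costs less than M.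

   Both transformations are functions on trees built from combinators (maps,
   concatenation, lookup, bounded iteration) that preserve computability in
   polynomial time. *)

Require Import Defs.
From mathcomp Require Import all_boot all_order all_algebra.
From mathcomp Require Import zify.

Import Order.TTheory GRing.Theory Num.Theory.
Import Defs.

Set Implicit Arguments.
Unset Strict Implicit.
Unset Printing Implicit Defensive.

(** * Polynomial-time functions on trees *)

(** The distinct numbers i tell the pairs apart: with equal capacities a tree could lead s_i to the
    sink of another pair. Old edges get capacity p, enough for every tree built from paths, where at
    most p terminals lie below a path vertex.

    The edges added at s'_p must not serve as shortcuts. A path of the tree from s_i to s'_i meets
    no other sink s'_j, which lies below s_j, and it stops at s'_i; so an added edge leaving s'_p is
    never taken, and only those entering s'_p call for an argument.

    The length M is 2 ^ b, where b is the total bit length of the numerators of all lengths. A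
    nonnegative rational is at most its numerator, a number is less than 2 to the power of its bit
    length, and a sum of such numbers is below the product of the powers; so M exceeds the sum of
    all lengths. Its binary expansion comes from concatenating digit lists, so no arithmetic on
    rationals has to be programmed.

    One adjacency matrix serves directed and undirected graphs, new edges being entered in both
    directions. *)

Definition poly_bounded (b : tree -> nat) : Prop :=
  exists k, forall v, b v <= (tsize v + 2) ^ k.

Definition polyf (f : tree -> tree) : Prop :=
  exists (c : cmd) (b : tree -> nat),
    poly_bounded b /\ forall v, exists2 t, runs c v (f v) t & t <= b v.

Lemma tsize_gt0 v : 0 < tsize v. Proof. by case: v. Qed.

Lemma leq_poly_bounded b b' :
  (forall v, b v <= b' v) -> poly_bounded b' -> poly_bounded b.
Proof. by move=> le [k hk]; exists k => v; apply: leq_trans (le v) (hk v). Qed.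

Lemma poly_bounded_const m : poly_bounded (fun => m).
Proof.
exists m => v; apply: leq_trans (ltnW (ltn_expl m (isT : 1 < 2))) _.
by case: m => // m; rewrite leq_exp2r // leq_addl.
Qed.

Lemma poly_boundedM b1 b2 : poly_bounded b1 -> poly_bounded b2 ->
  poly_bounded (fun v => b1 v * b2 v).
Proof.
move=> [k1 h1] [k2 h2]; exists (k1 + k2) => v.
by rewrite expnD leq_mul.
Qed.

(** Both powers are at least 1, so their sum is at most twice their product; the base [tsize v + 2]
    is at least 2 and absorbs the factor with one more power. *)
Lemma poly_boundedD b1 b2 : poly_bounded b1 -> poly_bounded b2 ->
  poly_bounded (fun v => b1 v + b2 v).
Proof.
move=> [k1 h1] [k2 h2]; exists (k1 + k2).+1 => v.
have ge1 k : 0 < (tsize v + 2) ^ k by rewrite expn_gt0 addn2.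
apply: leq_trans (leq_add (h1 v) (h2 v)) _.
rewrite expnS expnD.
apply: (@leq_trans (2 * ((tsize v + 2) ^ k1 * (tsize v + 2) ^ k2))); last first.
  by rewrite leq_mul2r leq_addl orbT.
by rewrite mul2n -addnn leq_add ?leq_pmulr ?leq_pmull.
Qed.

Lemma poly_boundedS b : poly_bounded b -> poly_bounded (fun v => (b v).+1).
Proof.
by move=> h; apply: leq_poly_bounded (poly_boundedD h (poly_bounded_const 1)) => v; rewrite addn1.
Qed.

Lemma poly_bounded_tsize : poly_bounded tsize.
Proof. by exists 1 => v; rewrite expn1 leq_addr. Qed.

Lemma poly_boundedX b k : poly_bounded b -> poly_bounded (fun v => b v ^ k).
Proof.
move=> h; elim: k => [|k IH]; first exact: poly_bounded_const.
by apply: leq_poly_bounded (poly_boundedM h IH) => v; rewrite expnS.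
Qed.

(** Storing a tree costs at least its size, so a stored tree is either old or no larger than the
    elapsed time. Time bounds thus bound outputs, as closure of [polyf] under composition
    requires. *)
Lemma exec_tsize c s s' t : exec c s s' t ->
  forall x, tsize (s' x) <= maxn (tsize (s x)) t.
Proof.
elim=> {c s s' t}.
- by move=> s x; rewrite leq_maxl.
- move=> s x e y; rewrite /upd; case: eqP => _; last by rewrite leq_maxl.
  by rewrite leq_max leqnSn orbT.
- move=> c1 c2 s1 s2 s3 t1 t2 _ h1 _ h2 x.
  apply: leq_trans (h2 x) _; rewrite geq_max [in t2 <= _]leq_max leq_addl orbT andbT.
  by apply: leq_trans (h1 x) _; rewrite geq_max leq_maxl leq_max leq_addr orbT.
- move=> e c1 c2 s s' t _ _ h x; apply: leq_trans (h x) _.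
  by rewrite geq_max leq_maxl leq_max leqnSn orbT.
- move=> e c1 c2 s s' t _ _ h x; apply: leq_trans (h x) _.
  by rewrite geq_max leq_maxl leq_max leqnSn orbT.
- move=> e c s1 s2 s3 t1 t2 _ _ h1 _ h2 x.
  apply: leq_trans (h2 x) _.
  rewrite geq_max [in t2 <= _]leq_max (leqW (leq_addl _ _)) orbT andbT.
  by apply: leq_trans (h1 x) _; rewrite geq_max leq_maxl leq_max (leqW (leq_addr _ _)) orbT.
- by move=> e c s _ x; rewrite leq_maxl.
- move=> x c e s s' t _ h y; rewrite /upd; case: eqP => _; last by rewrite leq_maxl.
  by rewrite leq_max (leqW (leq_addl _ _)) orbT.
Qed.

Lemma runs_tsize c v w t : runs c v w t -> tsize w <= tsize v + t.
Proof.
move=> [s' [/exec_tsize h <-]]; apply: leq_trans (h 0) _.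
by rewrite geq_max leq_addr leq_addl.
Qed.

Lemma runs_exec_call c s x e w t : runs c (eval s e) w t ->
  exec (Call x c e) s (upd s x w) (tsize (eval s e) + t + tsize w).+1.
Proof. by move=> [s' [h <-]]; apply: ExecCall. Qed.

Lemma poly_bounded_polyf f : polyf f -> poly_bounded (fun v => tsize (f v)).
Proof.
move=> [c [b [hb h]]].
apply: leq_poly_bounded (poly_boundedD poly_bounded_tsize hb) => v.
have [t /runs_tsize le1 le2] := h v.
by apply: leq_trans le1 _; rewrite leq_add2l.
Qed.

Lemma poly_bounded_comp b f :
  poly_bounded b -> polyf f -> poly_bounded (fun v => b (f v)).
Proof.
move=> [k hk] /poly_bounded_polyf hf.
by apply: leq_poly_bounded (poly_boundedX k (poly_boundedD hf (poly_bounded_const 2))).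
Qed.

Lemma polyf_id : polyf (fun v => v).
Proof.
exists Skip, (fun => 1); split; first exact: poly_bounded_const.
by move=> v; exists 1 => //; exists (init v); split => //; apply: ExecSkip.
Qed.

Lemma polyf_expr (e : expr) (f : tree -> tree) :
  (forall v, eval (init v) e = f v) -> poly_bounded (fun v => tsize (f v)) ->
  polyf f.
Proof.
move=> he hb; exists (Assign 0 e), (fun v => (tsize (f v)).+1).
split; first exact: poly_boundedS.
move=> v; exists (tsize (f v)).+1 => //.
exists (upd (init v) 0 (eval (init v) e)); split; first by rewrite -he; apply: ExecAssign.
by rewrite /upd eqxx he.
Qed.

Lemma polyf_leaf : polyf (fun => Leaf).
Proof. by apply: (@polyf_expr Nil) => //; apply: poly_bounded_const. Qed.

Lemma polyf_thead0 : polyf thead.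
Proof.
apply: (@polyf_expr (Hd (Var 0))) => //.
apply: leq_poly_bounded poly_bounded_tsize => -[|a b] //=.
by rewrite leqW // leq_addr.
Qed.

Lemma polyf_ttail0 : polyf ttail.
Proof.
apply: (@polyf_expr (Tl (Var 0))) => //.
apply: leq_poly_bounded poly_bounded_tsize => -[|a b] //=.
by rewrite leqW // leq_addl.
Qed.

Lemma polyf_comp f g : polyf f -> polyf g -> polyf (fun v => f (g v)).
Proof.
move=> pf pg; move: (pf) (pg) => [cf [bf [hbf hf]]] [cg [bg [hbg hg]]].
exists (Seq (Call 0 cg (Var 0)) (Call 0 cf (Var 0))).
exists (fun v => (tsize v + bg v + tsize (g v)).+1 +
                 (tsize (g v) + bf (g v) + tsize (f (g v))).+1); split.
  have sg := poly_bounded_polyf pg.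
  have sf := poly_bounded_comp (poly_bounded_polyf pf) pg.
  have sb := poly_bounded_comp hbf pg.
  by do ![apply: poly_boundedD || apply: poly_boundedS]; rewrite //; apply: poly_bounded_tsize.
move=> v; have [t1 r1 l1] := hg v; have [t2 r2 l2] := hf (g v).
eexists; first last; last first.
  exists (upd (upd (init v) 0 (g v)) 0 (f (g v))); split; last by [].
  apply: ExecSeq; apply: runs_exec_call; last exact: r2.
  exact: r1.
by apply: leq_add; rewrite ltnS leq_add2r leq_add2l.
Qed.

Lemma polyf_thead f : polyf f -> polyf (fun v => thead (f v)).
Proof. exact: polyf_comp polyf_thead0. Qed.

Lemma polyf_ttail f : polyf f -> polyf (fun v => ttail (f v)).
Proof. exact: polyf_comp polyf_ttail0. Qed.

Lemma polyf_node f g : polyf f -> polyf g -> polyf (fun v => Node (f v) (g v)).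
Proof.
move=> pf pg; move: (pf) (pg) => [cf [bf [hbf hf]]] [cg [bg [hbg hg]]].
exists (Seq (Call 1 cf (Var 0)) (Seq (Call 2 cg (Var 0)) (Assign 0 (Cons (Var 1) (Var 2))))).
exists (fun v => (tsize v + bf v + tsize (f v)).+1 +
                 ((tsize v + bg v + tsize (g v)).+1 + (tsize (f v) + tsize (g v)).+2)); split.
  have sg := poly_bounded_polyf pg.
  have sf := poly_bounded_polyf pf.
  by do ![apply: poly_boundedD || apply: poly_boundedS]; rewrite //; apply: poly_bounded_tsize.
move=> v; have [t1 r1 l1] := hf v; have [t2 r2 l2] := hg v.
eexists; first last; last first.
  exists (upd (upd (upd (init v) 1 (f v)) 2 (g v)) 0 (Node (f v) (g v))).
  split; last by [].
  apply: ExecSeq; first by apply: (@runs_exec_call _ _ _ (Var 0)); exact: r1.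
  apply: ExecSeq; first by apply: (@runs_exec_call _ _ _ (Var 0)); exact: r2.
  exact: (@ExecAssign _ 0 (Cons (Var 1) (Var 2))).
by rewrite /= leq_add // ltnS ?leq_add2r ?leq_add2l // leq_add2r leq_add2l.
Qed.

Definition tif (c a b : tree) : tree := if nonleaf c then a else b.

Lemma polyf_if h f g : polyf h -> polyf f -> polyf g ->
  polyf (fun v => tif (h v) (f v) (g v)).
Proof.
move=> ph pf pg; move: (ph) (pf) (pg).
move=> [ch [bh [hbh hh]]] [cf [bf [hbf hf]]] [cg [bg [hbg hg]]].
exists (Seq (Call 1 ch (Var 0)) (If (Var 1) (Call 0 cf (Var 0)) (Call 0 cg (Var 0)))).
exists (fun v => (tsize v + bh v + tsize (h v)).+1 +
   ((tsize v + bf v + tsize (f v)).+2 + (tsize v + bg v + tsize (g v)).+2)); split.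
  have sg := poly_bounded_polyf pg.
  have sf := poly_bounded_polyf pf.
  have sh := poly_bounded_polyf ph.
  by do ![apply: poly_boundedD || apply: poly_boundedS]; rewrite //; apply: poly_bounded_tsize.
move=> v; have [t r l] := hh v.
have [t1 r1 l1] := hf v; have [t2 r2 l2] := hg v.
rewrite /tif; case: ifP => hc; eexists; first last; last first.
- exists (upd (upd (init v) 1 (h v)) 0 (f v)); split; last by [].
  apply: ExecSeq; first by apply: (@runs_exec_call _ _ _ (Var 0)); exact: r.
  apply: ExecIfTrue; first exact: hc.
  by apply: (@runs_exec_call _ _ _ (Var 0)); exact: r1.
- rewrite leq_add //=; first by rewrite ltnS leq_add2r leq_add2l.
  by apply: leq_trans (leq_addr _ _); rewrite !ltnS leq_add2r leq_add2l.
- exists (upd (upd (init v) 1 (h v)) 0 (g v)); split; last by [].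
  apply: ExecSeq; first by apply: (@runs_exec_call _ _ _ (Var 0)); exact: r.
  apply: ExecIfFalse; first exact: negbT hc.
  by apply: (@runs_exec_call _ _ _ (Var 0)); exact: r2.
- rewrite leq_add //=; first by rewrite ltnS leq_add2r leq_add2l.
  by apply: leq_trans (leq_addl _ _); rewrite !ltnS leq_add2r leq_add2l.
Qed.

(** * Trees as lists *)

Fixpoint lst (v : tree) : seq tree := if v is Node a b then a :: lst b else [::].
Definition unl (s : seq tree) : tree := enc_seq id s.

Lemma lstK : cancel lst unl.
Proof. by elim=> //= a _ b IH; rewrite -[RHS]/(Node a b) -[in RHS]IH. Qed.

Lemma unlK : cancel unl lst.
Proof. by elim=> //= a s IH; congr cons. Qed.

Lemma lst_enc_seq X (enc : X -> tree) s : lst (enc_seq enc s) = map enc s.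
Proof. by elim: s => //= x s ->. Qed.

Lemma enc_seqE X (enc : X -> tree) s : enc_seq enc s = unl (map enc s).
Proof. by rewrite -lst_enc_seq lstK. Qed.

Lemma lst_unary n : lst (enc_unary n) = nseq n Leaf.
Proof. by elim: n => //= n ->. Qed.

Lemma unary_nseq n : enc_unary n = unl (nseq n Leaf).
Proof. by rewrite -lst_unary lstK. Qed.

Lemma size_lst v : size (lst v) <= tsize v.
Proof.
elim: v => //= a _ b IH; rewrite ltnS; apply: leq_trans IH _; exact: leq_addl.
Qed.

(* The last hypothesis is what keeps iteration polynomial: a procedure that
   squares its argument is in polynomial time, but its iterates are not. *)
Lemma polyf_iter_bounded (len ini : tree -> tree) (step : tree -> tree -> tree)
    (B : tree -> nat) :
  polyf len -> polyf ini -> polyf (fun u => step (thead u) (ttail u)) ->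
  poly_bounded B ->
  (forall v i, i <= size (lst (len v)) -> tsize (iter i (step v) (ini v)) <= B v) ->
  polyf (fun v => iter (size (lst (len v))) (step v) (ini v)).
Proof.
move=> pl pi ps hB leB; move: (pl) (pi) (ps).
move=> [cl [bl [hbl hl]]] [ci [bi [hbi hi]]] [cs [bs [[k hk] hs]]].
(* The body runs on [Node v x] with [tsize x <= B v], and [D] bounds its time: the [3] is 1 for
   [Node] plus the [2] of [poly_bounded]. [E] bounds one turn of the loop. *)
pose D v := (tsize v + B v + 3) ^ k.
pose E v := ((tsize (len v)).+1 + (tsize v + B v + 1 + D v + B v).+1).+1.
exists (Seq (Call 1 cl (Var 0)) (Seq (Call 2 ci (Var 0)) (Seq
  (While (Var 1) (Seq (Assign 1 (Tl (Var 1))) (Call 2 cs (Cons (Var 0) (Var 2)))))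
  (Assign 0 (Var 2))))).
exists (fun v => (tsize v + bl v + tsize (len v)).+1 +
   ((tsize v + bi v + tsize (ini v)).+1 + ((tsize (len v) * E v).+1 + (B v).+1))).
have sl := poly_bounded_polyf pl.
have si := poly_bounded_polyf pi.
split.
  have sz := poly_bounded_tsize.
  have hD : poly_bounded D.
    by apply: poly_boundedX; do ![apply: poly_boundedD]; rewrite //; apply: poly_bounded_const.
  have hE : poly_bounded E.
    by do ![apply: poly_boundedD || apply: poly_boundedS]; rewrite //; apply: poly_bounded_const.
  by do ![apply: poly_boundedD || apply: poly_boundedS]; rewrite //; apply: poly_boundedM.
move=> v.
have loop n l i s : i + n = size (lst (len v)) -> size (lst l) = n ->
    tsize l <= tsize (len v) ->
    s 0 = v -> s 1 = l -> s 2 = iter i (step v) (ini v) ->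
    exists2 t, exists2 s', exec (While (Var 1) (Seq (Assign 1 (Tl (Var 1)))
       (Call 2 cs (Cons (Var 0) (Var 2))))) s s' t &
       s' 2 = iter (size (lst (len v))) (step v) (ini v) & t <= (n * E v).+1.
  elim: n l i s => [|n IH] l i s ein el lel s0 s1 s2.
    exists 1 => //; exists s; last by rewrite s2 -ein addn0.
    by apply: ExecWhileFalse; rewrite /= s1; case: l el {lel s1}.
  case: l el lel s1 => // a l [el] lel s1.
  pose x := iter i (step v) (ini v).
  have [t r le] := hs (Node v x).
  have lex : tsize x <= B v by apply: leB; rewrite -ein leq_addr.
  have ley : tsize (step v x) <= B v by apply: (leB v i.+1); rewrite -ein -addSnnS leq_addr.
  have := IH l i.+1 (upd (upd s 1 l) 2 (step v x)).
  case=> //; first by rewrite addSnnS.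
    by apply: leq_trans lel => /=; rewrite leqW // leq_addl.
  move=> t' [s' ex <-] le'; eexists; first exists s' => //.
    apply: ExecWhileTrue; last exact: ex; first by rewrite /= s1.
    have -> : l = eval s (Tl (Var 1)) by rewrite /= s1.
    apply: ExecSeq; first exact: ExecAssign.
    apply: runs_exec_call; rewrite /= /upd /= s0 s2; exact: r.
  rewrite /= /upd /= s0 s1 s2 -/x.
  rewrite mulSn ltnS; apply: leq_trans (leq_add (leqnn _) le') _.
  rewrite addnS -addSn leq_add2r /E ltnS.
  apply: leq_add.
    by rewrite ltnS; apply: leq_trans lel; rewrite /= leqW // leq_addl.
  rewrite ltnS leq_add // leq_add //; first by rewrite addn1 ltnS leq_add2l.
  apply: leq_trans le _; apply: leq_trans (hk _) _.
  rewrite /D; have [->//|k0] := posnP k.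
  by rewrite leq_exp2r //= addn2 addn3 !ltnS leq_add2l.
have [t1 r1 l1] := hl v; have [t2 r2 l2] := hi v.
have := loop _ _ 0 (upd (upd (init v) 1 (len v)) 2 (ini v)) (add0n _) erefl
  (leqnn _) erefl erefl erefl.
move=> [t [s' ex es'] let'].
eexists; first last; last first.
  exists (upd s' 0 (s' 2)); split; last by rewrite /upd eqxx es'.
  apply: ExecSeq; first by apply: (@runs_exec_call _ _ _ (Var 0)); exact: r1.
  apply: ExecSeq; first by apply: (@runs_exec_call _ _ _ (Var 0)); exact: r2.
  apply: ExecSeq; first exact: ex.
  exact: ExecAssign.
rewrite leq_add //; first by rewrite /= ltnS leq_add2r leq_add2l.
rewrite leq_add //; first by rewrite /= ltnS leq_add2r leq_add2l.
rewrite leq_add //=; last by rewrite ltnS es' leB.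
by apply: leq_trans let' _; rewrite ltnS leq_mul // size_lst.
Qed.

(** A step adds at most [c v], which depends on the input and not on the accumulator, so sizes stay
    within [tsize (ini v) + tsize (len v) * c v]. [Inv] records what the growth bound must know of
    the accumulator, such as the size of a list still to be processed. *)
Lemma polyf_iter (Inv : tree -> tree -> Prop) (c : tree -> nat)
    (len ini : tree -> tree) (step : tree -> tree -> tree) :
  polyf len -> polyf ini -> polyf (fun u => step (thead u) (ttail u)) ->
  poly_bounded c -> (forall v, Inv v (ini v)) ->
  (forall v a, Inv v a -> Inv v (step v a) /\ tsize (step v a) <= tsize a + c v) ->
  polyf (fun v => iter (size (lst (len v))) (step v) (ini v)).
Proof.
move=> pl pi ps hc inv0 invS.
pose B v := tsize (ini v) + tsize (len v) * c v.
apply: (@polyf_iter_bounded _ _ _ B) => //.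
  apply: poly_boundedD; first exact: poly_bounded_polyf.
  by apply: poly_boundedM => //; exact: poly_bounded_polyf.
move=> v i lei.
have [_ le] : Inv v (iter i (step v) (ini v)) /\
              tsize (iter i (step v) (ini v)) <= tsize (ini v) + i * c v.
  elim: i {lei} => [|i [IH1 IH2]]; first by rewrite addn0.
  have [? le] := invS v _ IH1; split=> //.
  by apply: leq_trans le _; rewrite mulSn addnCA addnC leq_add2l.
apply: leq_trans le _; rewrite leq_add2l leq_mul //.
exact: leq_trans lei (size_lst _).
Qed.

Lemma polyf_ext f g : polyf f -> f =1 g -> polyf g.
Proof.
move=> [c [b [hb h]]] e; exists c, b; split=> // v.
by have [t r le] := h v; exists t => //; rewrite -e.
Qed.

(** Holding for all large exponents lets two programs share one. *)
Lemma polyf_runs_poly f : polyf f ->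
  exists c k, forall k', k <= k' -> forall v, runs_poly k' c v (f v).
Proof.
move=> [c [b [[k hk] h]]]; exists c, (2 * k + 3 ^ k) => k' lek' v.
have [t r le] := h v; exists t => //.
apply: leq_trans le (leq_trans (hk v) _).
(* From size 2 on, [tsize v + 2 <= tsize v ^ 2]. A leaf, of size 1, takes time at most [3 ^ k],
   which the additive constant covers. *)
have := tsize_gt0 v; case: (ltngtP (tsize v) 1) => // [gt1 _|-> _]; last first.
  by apply: leq_trans (leq_addl _ _); apply: leq_trans lek'; rewrite leq_addl.
apply: (@leq_trans (tsize v ^ k')); last exact: leq_addr.
apply: (@leq_trans ((tsize v ^ 2) ^ k)).
  case: k {hk lek'} => // k; rewrite leq_exp2r // -mulnn.
  apply: (@leq_trans (tsize v * 2)); last by rewrite leq_mul2l gt1 orbT.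
  by rewrite muln2 -addnn leq_add2l.
by rewrite -expnM leq_exp2l //; apply: leq_trans lek'; rewrite leq_addr.
Qed.

(** * Polynomial-time list operations and counting *)

Definition tmap (g : tree -> tree) (l : tree) : tree := unl (map g (lst l)).
Definition tcat (a b : tree) : tree := unl (lst a ++ lst b).
Definition tflat (l : tree) : tree := unl (flatten (map lst (lst l))).
(** [enc_unary i] is the list of [i] leaves; so here, in [teq] and in [tbin], a tree stands for the
    length of its list. *)
Definition tget (l i : tree) : tree := nth Leaf (lst l) (size (lst i)).
Definition teq (a b : tree) : tree := enc_bool (size (lst a) == size (lst b)).
Definition tiota (l : tree) : tree := enc_seq enc_unary (iota 0 (size (lst l))).
Definition tfirst (l : tree) : tree := head Leaf (filter nonleaf (lst l)).
Definition tbin (l : tree) : tree := enc_binary (size (lst l)).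

Lemma tsize_thead a : tsize (thead a) <= tsize a.
Proof. by case: a => //= a b; rewrite leqW // leq_addr. Qed.

Lemma tsize_ttail a : tsize (ttail a) <= tsize a.
Proof. by case: a => //= a b; rewrite leqW // leq_addl. Qed.

Lemma poly_bounded_step (g : tree -> tree -> tree) (L : tree -> tree) :
  polyf (fun u => g (thead u) (ttail u)) -> polyf L ->
  exists2 c, poly_bounded c &
    forall v x, tsize x <= tsize (L v) -> tsize (g v x) <= c v.
Proof.
move=> pg pL; have [k hk] := poly_bounded_polyf pg.
exists (fun v => (tsize v + tsize (L v) + 3) ^ k).
  apply: poly_boundedX; apply: poly_boundedD; last exact: poly_bounded_const.
  by apply: poly_boundedD; [exact: poly_bounded_tsize|exact: poly_bounded_polyf].
move=> v x le; apply: leq_trans (hk (Node v x)) _ => /=.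
case: k {hk} => // k; rewrite leq_exp2r // addn2 addn3 !ltnS.
by rewrite leq_add2l.
Qed.

(** A loop that consumes a list from its head stacks the results in reverse, so [catrev] is the
    primitive; mapping and concatenation come from reversing twice. The pending list never outgrows
    [L v], which bounds the arguments of [g]. *)
Lemma polyf_map_catrev (g : tree -> tree -> tree) (L A : tree -> tree) :
  polyf (fun u => g (thead u) (ttail u)) -> polyf L -> polyf A ->
  polyf (fun v => unl (catrev (map (g v) (lst (L v))) (lst (A v)))).
Proof.
move=> pg pL pA; have [c hc leg] := poly_bounded_step pg pL.
pose step v a := Node (ttail (thead a)) (Node (g v (thead (thead a))) (ttail a)).
apply: (@polyf_ext (fun v => ttail (iter (size (lst (L v))) (step v)
                                      (Node (L v) (A v))))); last first.
  move=> v; elim: (L v) (A v) => [|a _ l IH] s; first by rewrite /= lstK.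
  by rewrite [size _]/= iterSr IH.
apply: polyf_ttail.
apply: (@polyf_iter (fun v a => tsize (thead a) <= tsize (L v)) (fun v => c v + 4)) => //.
- exact: polyf_node.
- apply: polyf_node.
    do 3 apply: polyf_thead || apply: polyf_ttail; exact: polyf_id.
  apply: polyf_node; last by do 2 apply: polyf_ttail; exact: polyf_id.
  have pa := polyf_thead (polyf_thead (polyf_ttail polyf_id)).
  exact: polyf_ext (polyf_comp pg (polyf_node (polyf_thead polyf_id) pa)) _.
- by apply: poly_boundedD => //; exact: poly_bounded_const.
- move=> v a le; split; first by apply: leq_trans (tsize_ttail _) le.
  have le1 := leg v (thead (thead a)) (leq_trans (tsize_thead _) le).
  case: a {le} le1 => [|l acc] le1 /=.
    by rewrite addnC !addnS !addn0 !addSn !ltnS leqW // leqW.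
  have := tsize_ttail l; move: le1 => /=.
  set x := tsize _; set y := tsize _; set z := tsize l; set w := tsize _; lia.
Qed.

Lemma polyf_catrev f g : polyf f -> polyf g ->
  polyf (fun v => unl (catrev (lst (f v)) (lst (g v)))).
Proof.
move=> pf pg; have := polyf_map_catrev (g := fun _ x => x) (polyf_ttail polyf_id) pf pg.
by move/polyf_ext; apply => v; rewrite map_id.
Qed.

Lemma polyf_map (g : tree -> tree -> tree) (L : tree -> tree) :
  polyf (fun u => g (thead u) (ttail u)) -> polyf L ->
  polyf (fun v => tmap (g v) (L v)).
Proof.
move=> pg pL.
have p := polyf_map_catrev pg pL polyf_leaf.
have := polyf_catrev p polyf_leaf.
by move/polyf_ext; apply => v; rewrite /= unlK -!/(rev _) revK.
Qed.

Lemma polyf_cat f g : polyf f -> polyf g -> polyf (fun v => tcat (f v) (g v)).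
Proof.
move=> pf pg.
have := polyf_catrev (polyf_catrev pf polyf_leaf) pg.
by move/polyf_ext; apply => v; rewrite /= unlK [catrev _ (lst _)]catrevE -/(rev _) revK.
Qed.

Lemma tsize_unl s : tsize (unl s) = (sumn (map tsize s) + size s).+1.
Proof. by elim: s => //= a s ->; rewrite addnS addnA addnS. Qed.

Lemma tsize_tcat a b : tsize (tcat a b) = (tsize a + tsize b).-1.
Proof.
rewrite -{2}[a]lstK -{2}[b]lstK !tsize_unl map_cat sumn_cat size_cat.
by rewrite addSn addnS /=; congr S; rewrite addnACA.
Qed.

Lemma polyf_flat f : polyf f -> polyf (fun v => tflat (f v)).
Proof.
move=> pf.
have p := polyf_catrev pf polyf_leaf.
(* A block moves from the pending list to the accumulator, so the total size does not grow; the
   increment [2] given below covers the state [Leaf]. *)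
pose step (v a : tree) := Node (ttail (thead a)) (tcat (thead (thead a)) (ttail a)).
apply: (@polyf_ext (fun v => ttail (iter (size (lst (unl (rev (lst (f v)))))) (step v)
                                      (Node (unl (rev (lst (f v)))) Leaf)))); last first.
  move=> v; have E s acc : ttail (iter (size s) (step v) (Node (unl s) acc)) =
      tcat (unl (flatten (map lst (rev s)))) acc.
    elim: s acc => [|b s IH] acc; first by rewrite /tcat /= lstK.
    rewrite [size _]/= iterSr IH /step /tcat !unlK rev_cons map_rcons.
    by rewrite -cats1 flatten_cat /= cats0 catA.
  by rewrite unlK E revK /tcat unlK cats0.
apply: polyf_ttail.
apply: (@polyf_iter (fun _ _ => True) (fun v => 2)) => //.
- exact: polyf_node p polyf_leaf.
- apply: polyf_node; first by do 3 apply: polyf_thead || apply: polyf_ttail; exact: polyf_id.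
  by apply: polyf_cat; do ?[apply: polyf_thead || apply: polyf_ttail]; exact: polyf_id.
- exact: poly_bounded_const.
- move=> v a _; split=> //; rewrite /= tsize_tcat.
  case: a => [|[|l r] acc] //=; lia.
Qed.

Lemma polyf_iter_ttail f g : polyf f -> polyf g ->
  polyf (fun v => iter (size (lst (g v))) ttail (f v)).
Proof.
move=> pf pg; apply: (@polyf_iter (fun _ _ => True) (fun v => 0) _ _ (fun=> ttail)) => //.
- by do 2 apply: polyf_ttail; exact: polyf_id.
- exact: poly_bounded_const.
- by move=> v a _; rewrite addn0 tsize_ttail.
Qed.

Lemma lst_iter_ttail n l : lst (iter n ttail l) = drop n (lst l).
Proof.
elim: n l => [|n IH] l; first by rewrite drop0.
by rewrite iterSr IH; case: l.
Qed.

Lemma polyf_nth f g : polyf f -> polyf g -> polyf (fun v => tget (f v) (g v)).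
Proof.
move=> pf pg; have := polyf_thead (polyf_iter_ttail pf pg).
move/polyf_ext; apply=> v.
by rewrite /tget -[size (lst (g v))]addn0 -nth_drop -lst_iter_ttail addn0; case: (iter _ _ _).
Qed.

Lemma polyf_eq f g : polyf f -> polyf g -> polyf (fun v => teq (f v) (g v)).
Proof.
move=> pf pg.
have := polyf_if (polyf_iter_ttail pf pg) polyf_leaf
   (polyf_if (polyf_iter_ttail pg pf) polyf_leaf (polyf_node polyf_leaf polyf_leaf)).
move/polyf_ext; apply=> v; rewrite /tif /teq.
have E a b : nonleaf (iter (size (lst a)) ttail b) = (size (lst a) < size (lst b)).
  have -> w : nonleaf w = (0 < size (lst w)) by case: w.
  by rewrite lst_iter_ttail size_drop subn_gt0.
by rewrite !E; case: ltngtP.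
Qed.

Lemma polyf_first f : polyf f -> polyf (fun v => tfirst (f v)).
Proof.
move=> pf; pose step (v l : tree) := tif (thead l) l (ttail l).
apply: (@polyf_ext (fun v => thead (iter (size (lst (f v))) (step v) (f v)))); last first.
  move=> v; rewrite /tfirst; elim: (f v) => // a _ l IH.
  rewrite [size _]/= iterSr {2}/step /tif [thead _]/= [lst _]/= [filter _ _]/=.
  case: ifP => // ha.
  have -> n : iter n (step v) (Node a l) = Node a l; last by [].
  by elim: n => //= n ->; rewrite /step /tif /= ha.
apply: polyf_thead.
apply: (@polyf_iter (fun _ _ => True) (fun v => 0)) => //.
- by apply: polyf_if; do ?[apply: polyf_thead || apply: polyf_ttail]; exact: polyf_id.
- exact: poly_bounded_const.
- move=> v a _; split=> //; rewrite addn0 /step /tif; case: ifP => // _.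
  exact: tsize_ttail.
Qed.

Lemma map_const X Y (c : Y) (s : seq X) : map (fun=> c) s = nseq (size s) c.
Proof. by elim: s => //= x s ->. Qed.

(** The loop stacks the successive suffixes of the list, of lengths [n] down to [1]. Read from the
    top, with one entry dropped from each and the others replaced by leaves, they are [0] to [n - 1]
    in unary. *)
Lemma polyf_iota f : polyf f -> polyf (fun v => tiota (f v)).
Proof.
move=> pf; pose step (v a : tree) := Node (ttail (thead a)) (Node (thead a) (ttail a)).
have p : polyf (fun v => iter (size (lst (f v))) (step v) (Node (f v) Leaf)).
  apply: (@polyf_iter (fun v a => tsize (thead a) <= tsize (f v)) (fun v => tsize (f v) + 3)) => //.
  - by apply: polyf_node => //; exact: polyf_leaf.
  - by do ?[apply: polyf_thead || apply: polyf_ttail || apply: polyf_node]; exact: polyf_id.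
  - by apply: poly_boundedD (poly_bounded_const 3); exact: poly_bounded_polyf.
  - move=> v a le; split; first exact: leq_trans (tsize_ttail _) le.
    case: a le => [|l a] /= le; first by lia.
    have := tsize_ttail l; lia.
have q : polyf (fun u => tmap (fun _ => Leaf) (ttail (ttail u))).
  apply: (polyf_map (g := fun _ _ => Leaf)); first exact: polyf_leaf.
  by do 2 apply: polyf_ttail; exact: polyf_id.
have := polyf_map (g := fun v x => tmap (fun _ => Leaf) (ttail x)) q (polyf_ttail p).
move/polyf_ext; apply => v.
have -> l acc : ttail (iter (size (lst l)) (step v) (Node l acc)) =
    unl ([seq iter i ttail l | i <- rev (iota 0 (size (lst l)))] ++ lst acc).
  elim: l acc => [|a _ l IH] acc; first by rewrite lstK.
  rewrite [size _]/= iterSr {2}/step /= IH rev_cons map_rcons cat_rcons /=.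
  congr (unl (_ ++ _)); rewrite (iotaDl 1 0) -map_rev -map_comp.
  by apply: eq_map => i; rewrite /comp add1n iterSr.
rewrite /tmap /tiota unlK cats0 enc_seqE; congr unl.
set n := size _; rewrite -map_comp.
have -> : rev (iota 0 n) = [seq n - i.+1 | i <- iota 0 n].
  apply: (@eq_from_nth _ 0); first by rewrite size_rev size_map.
  move=> i; rewrite size_rev size_iota => lti.
  rewrite nth_rev ?size_iota // (nth_map 0) ?size_iota // !nth_iota; lia.
rewrite -map_comp; apply/eq_in_map => i; rewrite mem_iota => /andP[_]; rewrite add0n => lti.
rewrite /= unary_nseq -iterS lst_iter_ttail map_const size_drop -/n.
by congr (unl (nseq _ _)); lia.
Qed.

(** Binary increment with carry. A carry past the last digit meets the implicit leading 1 and leaves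
    a zero under a new leading 1: the final [Node Leaf Leaf] is a one-digit list, not the digit
    1. *)
Fixpoint tsucc_pos (t : tree) : tree :=
  if t is Node d t' then
    if nonleaf d then Node Leaf (tsucc_pos t') else Node (Node Leaf Leaf) t'
  else Node Leaf Leaf.

Lemma enc_pos_succ b : tsucc_pos (enc_pos b) = enc_pos (PosDef.Pos.succ b).
Proof. by elim: b => //= b ->. Qed.

Definition tsucc (t : tree) : tree :=
  tif t (Node Leaf (tsucc_pos (ttail t))) (Node Leaf Leaf).

Lemma enc_binaryS n : tsucc (enc_binary n) = enc_binary n.+1.
Proof.
case: n => // n; rewrite /enc_binary.
case E: (bin_of_nat n.+1) => [|b]; first by [].
have -> : n.+2 = nat_of_bin (BinNums.Npos (PosDef.Pos.succ b)).
  by rewrite /= nat_of_succ_pos -[n.+1]bin_of_natK E.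
by rewrite nat_of_binK /tsucc /tif /= enc_pos_succ.
Qed.

Lemma tsize_tsucc_pos t : tsize (tsucc_pos t) <= tsize t + 2.
Proof. elim: t => //= d _ t IH; case: d => [|d1 d2] /=; lia. Qed.

(** The loop moves the initial ones to a stack of zeros and stalls at the first zero or at the end;
    [fin] puts the zeros back in front of the incremented rest. Zeros being leaves, the stack is a
    unary number. *)
Lemma polyf_succ_pos f : polyf f -> polyf (fun v => tsucc_pos (f v)).
Proof.
move=> pf.
pose step (v a : tree) := tif (thead (thead a)) (Node (ttail (thead a)) (Node Leaf (ttail a))) a.
pose fin a := tcat (ttail a)
  (tif (thead a) (Node (Node Leaf Leaf) (ttail (thead a))) (Node Leaf Leaf)).
apply: (@polyf_ext (fun v => fin (iter (size (lst (f v))) (step v) (Node (f v) Leaf)))); last first.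
  move=> v.
  have E t j : fin (iter (size (lst t)) (step v) (Node t (enc_unary j))) =
               unl (nseq j Leaf ++ lst (tsucc_pos t)).
    elim: t j => [|d _ t IH] j; first by rewrite /fin /tcat lst_unary.
    rewrite [size _]/= iterSr {2}/step /tif [thead _]/=.
    case: d => [|d1 d2] /=; last first.
      by rewrite (IH j.+1) -[in RHS]cat_rcons -cats1 -(nseqD j 1) addn1.
    rewrite (_ : iter _ _ _ = Node (Node Leaf t) (enc_unary j)).
      by rewrite /fin /tcat lst_unary.
    by elim: (size _) => //= n ->.
  by rewrite (E _ 0) lstK.
have p : polyf (fun v => iter (size (lst (f v))) (step v) (Node (f v) Leaf)).
  apply: (@polyf_iter (fun _ _ => True) (fun v => 2)) => //.
  - exact: polyf_node pf polyf_leaf.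
  - by do ?[apply: polyf_if || apply: polyf_node || apply: polyf_thead ||
            apply: polyf_ttail || exact: polyf_leaf]; exact: polyf_id.
  - exact: poly_bounded_const.
  - move=> v a _; split=> //; rewrite /step /tif.
    by case: a => [|[|[|d1 d2] r] z] //=; lia.
by do ?[apply: polyf_cat || apply: polyf_if || exact: p || apply: polyf_node ||
        apply: polyf_thead || apply: polyf_ttail || exact: polyf_leaf].
Qed.

Lemma polyf_bin f : polyf f -> polyf (fun v => tbin (f v)).
Proof.
move=> pf; pose step (v a : tree) := tif a (Node Leaf (tsucc_pos (ttail a))) (Node Leaf Leaf).
apply: (@polyf_ext (fun v => iter (size (lst (f v))) (step v) Leaf)); last first.
  move=> v; rewrite /tbin; elim: (size _) => //= n ->.
  by rewrite -enc_binaryS.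
apply: (@polyf_iter (fun _ _ => True) (fun v => 3)) => //.
- exact: polyf_leaf.
- by do ?[apply: polyf_if || apply: polyf_succ_pos || apply: polyf_node ||
          apply: polyf_thead || apply: polyf_ttail || exact: polyf_leaf]; exact: polyf_id.
- exact: poly_bounded_const.
- move=> v a _; split=> //; rewrite /step /tif.
  by case: a => [|d t] //=; have := tsize_tsucc_pos t; lia.
Qed.

Lemma polyf_const c : polyf (fun=> c).
Proof. by elim: c => [|a pa b pb]; [exact: polyf_leaf|exact: polyf_node pa pb]. Qed.

Ltac poly := do ?[exact: polyf_id | exact: polyf_const | apply: polyf_map => /= |
  apply: polyf_if | apply: polyf_cat | apply: polyf_flat | apply: polyf_nth |
  apply: polyf_eq | apply: polyf_first | apply: polyf_iota | apply: polyf_bin |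
  apply: polyf_node | apply: polyf_thead | apply: polyf_ttail].

(** * The reduction as a function on trees *)

Section TreeReduction.
Variable v : tree.

Definition t_src i := thead (tget (ttail v) i).
Definition t_snk i := ttail (tget (ttail v) i).
Definition t_n := tmap (fun=> Leaf) (thead v).
Definition t_owners :=
  tflat (tmap (fun i => tmap (fun=> t_snk i) (Node Leaf i)) (tiota (ttail v))).
(** The selectors reach the numerator digits of an entry [Some w]; on a missing edge they all return
    [Leaf], the empty list. *)
Definition t_bits := tmap (fun=> Leaf)
  (tflat (tmap (fun r => tflat (tmap (fun o => ttail (thead (ttail o))) r)) (thead v))).
(* [2 ^ m], where [t_bits] is [m] in unary: its binary expansion is [m] zeros
   under the implicit leading 1, and zeros are leaves. *)
Definition t_big := Node (Node Leaf (Node Leaf t_bits)) (enc_int 1).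
Definition t_term k := tcat t_n (Node Leaf k).
(** [Node Leaf i] is [i + 1] in unary, the capacity of the [i]-th source edge. [ttail (ttail v)] is
    the list of pairs without its first, of length [p - 1], so as an index it designates the last
    pair. *)
Definition t_new :=
  tcat (tmap (fun i => Node (Node t_n (t_src i)) (Node (enc_rat 0) (tbin (Node Leaf i))))
          (tiota (ttail v)))
 (tcat (tmap (fun k => Node (Node (tget t_owners k) (t_term k))
                            (Node (enc_rat 0) (enc_binary 1))) (tiota t_owners))
       (tmap (fun x => Node (Node (t_snk (ttail (ttail v))) x) (Node t_big (enc_binary 1)))
          (tiota (Node Leaf t_n)))).
Definition t_look x y :=
  tfirst (tmap (fun u => tif (teq (thead (thead u)) x)
    (tif (teq (ttail (thead u)) y) (Node Leaf (ttail u)) Leaf) Leaf) t_new).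
Definition t_old x y := tget (tget (thead v) x) y.
Definition t_ent x y :=
  tif (teq x y) Leaf
 (tif (t_old x y) (Node Leaf (Node (ttail (t_old x y)) (tbin (ttail v))))
 (tif (t_look x y) (t_look x y) (t_look y x))).
Definition t_vertices := tiota (Node Leaf (tcat t_n t_owners)).
Definition t_reduction :=
  Node (tmap (fun x => tmap (fun y => t_ent x y) t_vertices) t_vertices)
       (Node t_n (tmap (fun k => t_term k) (tiota t_owners))).
End TreeReduction.

Lemma polyf_t_n f : polyf f -> polyf (fun v => t_n (f v)).
Proof. by move=> pf; apply: polyf_comp pf; rewrite /t_n; poly. Qed.
Lemma polyf_t_owners f : polyf f -> polyf (fun v => t_owners (f v)).
Proof. by move=> pf; apply: polyf_comp pf; rewrite /t_owners /t_snk; poly. Qed.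
Lemma polyf_t_new f : polyf f -> polyf (fun v => t_new (f v)).
Proof.
move=> pf; apply: polyf_comp pf; rewrite /t_new /t_src /t_snk /t_term /t_big /t_bits.
by do ?[poly; apply: polyf_t_n || apply: polyf_t_owners]; poly.
Qed.
Lemma polyf_t_reduction : polyf t_reduction.
Proof.
rewrite /t_reduction /t_vertices /t_ent /t_old /t_look /t_term.
by do ?[poly; apply: polyf_t_n || apply: polyf_t_owners || apply: polyf_t_new]; poly.
Qed.

(** * Tree operations on encoded data *)

Section Encodings.
Variables (X Y : Type) (enc : X -> tree).

Lemma eq_enc_seq (enc' : X -> tree) s : enc =1 enc' -> enc_seq enc s = enc_seq enc' s.
Proof. by move=> h; elim: s => //= x s ->; rewrite h. Qed.

Lemma tmap_enc g s : tmap g (enc_seq enc s) = enc_seq (fun x => g (enc x)) s.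
Proof. by rewrite /tmap lst_enc_seq enc_seqE -map_comp. Qed.

Lemma enc_seq_map (f : Y -> X) s : enc_seq enc (map f s) = enc_seq (fun x => enc (f x)) s.
Proof. by rewrite !enc_seqE -map_comp. Qed.

Lemma tiota_enc s : tiota (enc_seq enc s) = enc_seq enc_unary (iota 0 (size s)).
Proof. by rewrite /tiota lst_enc_seq size_map. Qed.

Lemma tcat_enc s s' : tcat (enc_seq enc s) (enc_seq enc s') = enc_seq enc (s ++ s').
Proof. by rewrite /tcat !lst_enc_seq enc_seqE map_cat. Qed.

Lemma tflat_enc s : tflat (enc_seq (enc_seq enc) s) = enc_seq enc (flatten s).
Proof.
rewrite /tflat lst_enc_seq enc_seqE map_flatten -map_comp; congr (unl (flatten _)).
by apply: eq_map => r /=; rewrite lst_enc_seq.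
Qed.

Lemma size_lst_enc s : size (lst (enc_seq enc s)) = size s.
Proof. by rewrite lst_enc_seq size_map. Qed.

Lemma size_lst_unary n : size (lst (enc_unary n)) = n.
Proof. by rewrite lst_unary size_nseq. Qed.

Lemma tget_enc x0 s i : i < size s ->
  tget (enc_seq enc s) (enc_unary i) = enc (nth x0 s i).
Proof. by move=> lt; rewrite /tget size_lst_unary lst_enc_seq (nth_map x0). Qed.

Lemma tget_enc_default s i : size s <= i ->
  tget (enc_seq enc s) (enc_unary i) = Leaf.
Proof. by move=> le; rewrite /tget size_lst_unary lst_enc_seq nth_default ?size_map. Qed.

Lemma tfirst_enc s : tfirst (enc_seq (enc_opt enc) s) = enc_opt enc (ohead (pmap id s)).
Proof. by rewrite /tfirst lst_enc_seq; elim: s => //= -[x|] s. Qed.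

Lemma tmap_leaf s : tmap (fun=> Leaf) (enc_seq enc s) = enc_unary (size s).
Proof. by rewrite /tmap map_const size_lst_enc unary_nseq. Qed.

End Encodings.

Lemma tcat_unary m n : tcat (enc_unary m) (enc_unary n) = enc_unary (m + n).
Proof. by rewrite /tcat !lst_unary -nseqD unary_nseq. Qed.

Lemma teq_unary m n : teq (enc_unary m) (enc_unary n) = enc_bool (m == n).
Proof. by rewrite /teq !size_lst_unary. Qed.

Lemma tif_bool (b : bool) x y : tif (enc_bool b) x y = if b then x else y.
Proof. by case: b. Qed.

Lemma tbin_enc n : tbin (enc_unary n) = enc_binary n.
Proof. by rewrite /tbin size_lst_unary. Qed.

Lemma enc_binary_exp2 m : enc_binary (2 ^ m) = Node Leaf (enc_unary m).
Proof.
rewrite /enc_binary.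
have -> : 2 ^ m = nat_of_bin (BinNums.Npos (iter m BinNums.xO BinNums.xH)).
  by elim: m => //= m; rewrite expnS => ->; rewrite mul2n NatTrec.doubleE.
by rewrite nat_of_binK /=; congr Node; elim: m => //= m ->.
Qed.

(** * The target instance and the correctness of its encoding *)

Section Gadget.
Variable I : vdp_inst.
Local Notation n := (vdp_n I).

(* In the target graph, vertex [n] is the root and [n + k.+1] is the terminal
   hanging on the sink [nth 0 owners k]. Pairs are numbered from 0, so the
   i-th source edge has capacity [i.+1]. *)
Definition nat_pairs : seq (nat * nat) :=
  [seq (val st.1, val st.2) | st <- vdp_pairs I].
Local Notation p := (size (vdp_pairs I)).
Definition src i := (nth (0, 0) nat_pairs i).1.
Definition snk i := (nth (0, 0) nat_pairs i).2.
Definition rows : seq (seq (option rat)) :=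
  [seq [seq if vdp_edge x y then Some (vdp_len x y) else None | y <- enum 'I_n]
     | x <- enum 'I_n].
Definition old x y := nth None (nth [::] rows x) y.
Definition owners := flatten [seq nseq i.+1 (snk i) | i <- iota 0 p].
Local Notation q := (size owners).
(** [enc_binary] puts one leaf before the digits below the leading 1, so this is the bit length,
    with [0] for [0]. *)
Definition bitlen m := size (lst (enc_binary m)).
Definition num_bits (o : option rat) := if o is Some w then bitlen `|numq w|%N else 0.
Definition bits := sumn [seq sumn [seq num_bits o | o <- r] | r <- rows].
Definition big_len : rat := (2 ^ bits)%:R.
Definition new_edges : seq ((nat * nat) * (rat * nat)) :=
  [seq ((n, src i), (0%R : rat, i.+1)) | i <- iota 0 p] ++
  [seq ((nth 0 owners k, n + k.+1), (0%R : rat, 1)) | k <- iota 0 q] ++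
  [seq ((snk p.-1, x), (big_len, 1)) | x <- iota 0 n.+1].
Definition look x y := ohead [seq u.2 | u <- new_edges & u.1 == (x, y)].
(** New edges are entered in both directions even in a directed graph, where the root reaches the
    last sink by the reverse of a listed edge. An old edge takes precedence over a new one; the
    first test drops the loop listed in the star at the last sink. *)
Definition ent x y : option (rat * nat) :=
  if x == y then None else
  if old x y is Some w then Some (w, p) else
  if look x y is Some c then Some c else look y x.

Definition reduction : cst_inst :=
  @CstInst (n + q).+1 (fun x y => ent x y : bool)
    (fun x y => (odflt (0%R, 1) (ent x y)).1) (fun x y => (odflt (0%R, 1) (ent x y)).2)
    (inord n) [set x : 'I_(n + q).+1 | n < x].

End Gadget.

Section Encoding.
Variable I : vdp_inst.
Local Notation n := (vdp_n I).
Local Notation p := (size (vdp_pairs I)).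
Local Notation q := (size (owners I)).
Let v := vdp_enc_inst I.

Lemma enc_rows : thead v = enc_seq (enc_seq (enc_opt enc_rat)) (rows I).
Proof. by []. Qed.

Lemma enc_nat_pairs :
  ttail v = enc_seq (enc_pair enc_unary enc_unary) (nat_pairs I).
Proof. by rewrite enc_seq_map. Qed.

Lemma size_nat_pairs : size (nat_pairs I) = p.
Proof. by rewrite size_map. Qed.

Lemma t_nE : t_n v = enc_unary n.
Proof. by rewrite /t_n enc_rows tmap_leaf size_map size_enum_ord. Qed.

Lemma t_srcE i : i < p -> t_src v (enc_unary i) = enc_unary (src I i).
Proof. by move=> lt; rewrite /t_src enc_nat_pairs (tget_enc _ (0, 0)) ?size_nat_pairs. Qed.

Lemma t_snkE i : i < p -> t_snk v (enc_unary i) = enc_unary (snk I i).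
Proof. by move=> lt; rewrite /t_snk enc_nat_pairs (tget_enc _ (0, 0)) ?size_nat_pairs. Qed.

Lemma eq_in_enc_seq (X : eqType) (e e' : X -> tree) s :
  {in s, e =1 e'} -> enc_seq e s = enc_seq e' s.
Proof. by move=> h; rewrite !enc_seqE; congr unl; apply/eq_in_map. Qed.

Lemma tiota_pairs : tiota (ttail v) = enc_seq enc_unary (iota 0 p).
Proof. by rewrite enc_nat_pairs tiota_enc size_nat_pairs. Qed.

Lemma tiota_unary m : tiota (enc_unary m) = enc_seq enc_unary (iota 0 m).
Proof. by rewrite /tiota size_lst_unary. Qed.

Lemma t_ownersE : t_owners v = enc_seq enc_unary (owners I).
Proof.
rewrite /t_owners tiota_pairs tmap_enc /owners -tflat_enc enc_seq_map.
congr tflat; apply: eq_in_enc_seq => i; rewrite mem_iota => /= lt.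
rewrite -[Node Leaf (enc_unary i)]/(enc_unary i.+1) t_snkE //.
by rewrite /tmap map_const size_lst_unary enc_seqE map_nseq.
Qed.

Lemma t_bitsE : t_bits v = enc_unary (bits I).
Proof.
rewrite /t_bits enc_rows tmap_enc.
rewrite (@eq_enc_seq _ _ (enc_seq id \o (fun r : seq (option rat) =>
  flatten [seq lst (enc_binary (if o is Some w then `|numq w|%N else 0)) | o <- r])));
  last first.
  move=> r /=; rewrite tmap_enc -tflat_enc enc_seq_map; congr tflat.
  by apply: eq_enc_seq => -[w|] //=; rewrite -[in LHS](lstK (enc_binary _)).
rewrite -enc_seq_map tflat_enc tmap_leaf; congr enc_unary.
rewrite size_flatten /shape -map_comp; congr sumn; apply: eq_map => r /=.
rewrite size_flatten /shape -map_comp; congr sumn; apply: eq_map => -[w|] //=.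
Qed.

Lemma enc_rat_nat m : enc_rat m%:R%R = Node (Node Leaf (enc_binary m)) (enc_int 1).
Proof.
rewrite /enc_rat; have -> : (m%:R : rat)%R = (m%:~R)%R by [].
by rewrite numq_int denq_int /enc_int /=.
Qed.

Lemma t_bigE : t_big v = enc_rat (big_len I).
Proof. by rewrite enc_rat_nat enc_binary_exp2 -t_bitsE. Qed.

Definition enc_edge := enc_pair (enc_pair enc_unary enc_unary) (enc_pair enc_rat enc_binary).

(** This order matches the [k]-th terminal with the [k]-th entry of [owners]; it serves both the
    encoding and the counting of terminals. *)
Lemma enum_term : map val (enum (cst_term (reduction I))) = iota n.+1 q.
Proof.
have -> : map val (enum (cst_term (reduction I))) = [seq k <- iota 0 (n + q).+1 | n < k].
  rewrite -val_enum_ord filter_map {1}/enum_mem -enumT; congr map.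
  by apply: eq_filter => k; rewrite /= inE.
rewrite -addSn iotaD filter_cat add0n.
rewrite (_ : filter _ (iota 0 n.+1) = [::]) ?cat0s; last first.
  by apply/eqP; rewrite -(negbK (_ == _)) -has_filter; apply/hasPn => k; rewrite mem_iota; lia.
by apply/all_filterP/allP => k; rewrite mem_iota; lia.
Qed.

Hypothesis p_gt0 : 0 < p.

Lemma t_termE k : t_term v (enc_unary k) = enc_unary (n + k.+1).
Proof. by rewrite /t_term t_nE -[Node _ _]/(enc_unary k.+1) tcat_unary. Qed.

Lemma t_newE : t_new v = enc_seq enc_edge (new_edges I).
Proof.
rewrite /t_new tiota_pairs t_ownersE tiota_enc t_nE -[Node Leaf (enc_unary n)]/(enc_unary n.+1).
rewrite tiota_unary !tmap_enc /new_edges -!tcat_enc !enc_seq_map.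
congr tcat; [|congr tcat]; apply: eq_in_enc_seq => i; rewrite mem_iota add0n => /= lt.
- by rewrite -[Node Leaf (enc_unary i)]/(enc_unary i.+1) tbin_enc t_srcE.
- by rewrite t_termE (tget_enc _ 0).
- rewrite t_bigE (_ : t_snk v _ = enc_unary (snk I p.-1)) //.
  rewrite -t_snkE ?ltn_predL // /t_snk /tget size_lst_unary.
  rewrite (_ : size (lst (ttail (ttail v))) = p.-1) // enc_nat_pairs -size_nat_pairs.
  by case: (nat_pairs I) => // u s; rewrite -[ttail _]/(enc_seq _ s) size_lst_enc.
Qed.

Lemma t_lookE x y :
  t_look v (enc_unary x) (enc_unary y) =
  enc_opt (enc_pair enc_rat enc_binary) (look I x y).
Proof.
rewrite /t_look t_newE tmap_enc.
rewrite (@eq_enc_seq _ _ (fun u => enc_opt (enc_pair enc_rat enc_binary)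
   (if u.1 == (x, y) then Some u.2 else None))); last first.
  move=> [[a b] c]; rewrite /= !teq_unary !tif_bool xpair_eqE.
  by case: eqP => //= _; case: eqP.
rewrite -enc_seq_map tfirst_enc /look; congr (enc_opt _ (ohead _)).
by elim: (new_edges I) => //= u s IH; case: eqP => _ /=; rewrite IH.
Qed.

Lemma t_oldE x y :
  t_old v (enc_unary x) (enc_unary y) = enc_opt enc_rat (old I x y).
Proof.
rewrite /t_old enc_rows /old.
have [lt|le] := ltnP x (size (rows I)); last first.
  by rewrite tget_enc_default // (nth_default [::] le) nth_nil /tget nth_nil.
rewrite (tget_enc _ [::]) //; set r := nth _ _ _.
have [lt'|le] := ltnP y (size r); first by rewrite (tget_enc _ None).
by rewrite tget_enc_default // nth_default.
Qed.

Lemma t_entE x y :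
  t_ent v (enc_unary x) (enc_unary y) =
  enc_opt (enc_pair enc_rat enc_binary) (ent I x y).
Proof.
rewrite /t_ent /ent teq_unary tif_bool; case: eqP => // _.
rewrite t_oldE; case: (old I x y) => [w|].
  by rewrite /tbin enc_nat_pairs size_lst_enc size_nat_pairs.
by rewrite /tif /= !t_lookE; case: (look I x y).
Qed.

Lemma t_reductionE : t_reduction v = cst_enc_inst (reduction I).
Proof.
have vE : t_vertices v = enc_seq enc_unary (iota 0 (n + q).+1).
  rewrite /t_vertices t_nE t_ownersE /tiota /= unlK size_cat.
  by rewrite size_lst_unary size_lst_enc.
rewrite /t_reduction /cst_enc_inst vE t_nE t_ownersE tiota_enc !tmap_enc.
congr Node.
  rewrite /enc_graph -val_enum_ord enc_seq_map [RHS]enc_seq_map.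
  apply: eq_enc_seq => x; rewrite tmap_enc enc_seq_map [RHS]enc_seq_map.
  apply: eq_enc_seq => y; rewrite t_entE.
  by rewrite /=; case: (ent I x y) => [[]|].
congr Node; first by rewrite /enc_vertex /= inordK // ltnS leq_addr.
rewrite (@eq_enc_seq _ (fun k => t_term v (enc_unary k))
  (fun k => enc_unary (n + k.+1))); last first.
  by move=> k; rewrite t_termE.
rewrite -(enc_seq_map enc_unary (fun k => n + k.+1)).
rewrite [RHS](_ : _ = enc_seq enc_unary (map val (enum (cst_term (reduction I))))); last first.
  by rewrite enc_seq_map.
congr enc_seq.

by rewrite enum_term -[n.+1]addn0 iotaDl; apply: eq_map => k; rewrite addSnnS.
Qed.

End Encoding.

(** * Reading off the paths *)

Definition t_parent (arcs y : tree) : tree :=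
  ttail (tfirst (tmap (fun a => tif (teq (ttail a) y) (Node Leaf (thead a)) Leaf) arcs)).

(** [w] holds the arcs and the pair; [a] holds the current vertex and the path from it to the sink.
    The climb stalls once at the source, so a number of turns larger than the path length is
    harmless. *)
Definition t_climb (w a : tree) : tree :=
  tif (teq (thead a) (thead (ttail w))) a
      (Node (t_parent (thead w) (thead a)) (Node (t_parent (thead w) (thead a)) (ttail a))).

Definition t_walk (w : tree) : tree :=
  ttail (iter (size (lst (thead w))) (t_climb w)
              (Node (ttail (ttail w)) (Node (ttail (ttail w)) Leaf))).

Definition t_extract (v : tree) : tree :=
  tmap (fun st => t_walk (Node (ttail v) st)) (ttail (thead v)).

Lemma t_parent_node a l y :
  t_parent (Node a l) y = if nonleaf (teq (ttail a) y) then thead a else t_parent l y.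
Proof. by rewrite /t_parent /tmap /tfirst /= /tif; case: (nonleaf (teq (ttail a) y)). Qed.

(** The parent is a piece of the arc list, so a climbing step, which stores it twice, adds an amount
    that depends on the arcs only. *)
Lemma tsize_t_parent arcs y : tsize (t_parent arcs y) <= tsize arcs.
Proof.
elim: arcs => // a _ l IH; rewrite t_parent_node /=; case: ifP => _.
  by apply: leq_trans (tsize_thead a) _; rewrite leqW // leq_addr.
by apply: leq_trans IH _; rewrite leqW // leq_addl.
Qed.

Lemma polyf_t_walk : polyf t_walk.
Proof.
apply: polyf_ttail.
apply: (@polyf_iter (fun _ _ => True) (fun w => tsize (thead w) + tsize (thead w) + 2) thead
   (fun w => Node (ttail (ttail w)) (Node (ttail (ttail w)) Leaf))) => //.
- exact: polyf_thead0.
- by poly.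
- by rewrite /t_climb /t_parent; poly.
- have h := poly_bounded_polyf polyf_thead0.
  exact: poly_boundedD (poly_boundedD h h) (poly_bounded_const 2).
- move=> w a _; split=> //; rewrite /t_climb /tif; case: ifP => _; first by lia.
  have := tsize_t_parent (thead w) (thead a); have := tsize_ttail a => /=; lia.
Qed.

Lemma polyf_t_extract : polyf t_extract.
Proof.
rewrite /t_extract; apply: polyf_map; last by poly.
by apply: (polyf_comp polyf_t_walk); poly.
Qed.

Section Walk.
Variable arcs : seq (nat * nat).
Hypothesis uniq_arcs : uniq (unzip2 arcs).
Let w s d := Node (enc_seq (enc_pair enc_unary enc_unary) arcs)
                  (Node (enc_unary s) (enc_unary d)).

Lemma t_parentE x y : (x, y) \in arcs ->
  t_parent (enc_seq (enc_pair enc_unary enc_unary) arcs) (enc_unary y) = enc_unary x.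
Proof.
elim: arcs uniq_arcs => // -[a b] l IH /= /andP[nb ul].
rewrite inE t_parent_node teq_unary /= xpair_eqE.
have [eby|nby] := eqVneq b y => /=.
  case/orP => [/andP[/eqP-> _] //|m]; case/negP: nb.
  by rewrite eby; apply/mapP; exists (x, y).
by rewrite andbF; exact: IH.
Qed.

Lemma t_walkE x q : path (fun a b => (a, b) \in arcs) x q -> uniq (x :: q) ->
  t_walk (w x (last x q)) = enc_seq enc_unary (x :: q).
Proof.
move=> pq uq; rewrite /t_walk.
have climb q' tl : path (fun a b => (a, b) \in arcs) x q' -> uniq (x :: q') ->
    iter (size q') (t_climb (w x (last x q)))
      (Node (enc_unary (last x q')) (enc_seq enc_unary (last x q' :: tl))) =
    Node (enc_unary x) (enc_seq enc_unary (x :: q' ++ tl)).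
  elim/last_ind: q' tl => [|q' z IH] tl //.
  rewrite rcons_path => /andP[p' pz] u'.
  rewrite size_rcons iterSr last_rcons {2}/t_climb /= teq_unary.
  have /negPf-> : z != x.
    by move: u'; rewrite -rcons_cons /= mem_rcons inE negb_or eq_sym => /andP[/andP[]].
  rewrite /tif /= (t_parentE pz) cat_rcons -IH //.
  by move: u'; rewrite -rcons_cons rcons_uniq => /andP[].
(* The vertices of [q] are distinct heads of arcs, so one turn per arc is enough; the remaining
   turns stall at [x]. *)
have le : size q <= size arcs.
  rewrite -(size_map snd); apply: uniq_leq_size; first by case/andP: uq.
  move=> y; elim: q x pq {uq climb} => //= z q IH x /andP[xz /IH{}IH].
  by rewrite inE => /orP[/eqP->|//]; apply/mapP; exists (x, z).
have := climb q [::] pq uq; rewrite cats0 [thead _]/= size_lst_enc -(subnK le) iterD.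
move=> ->; elim: (size arcs - size q) => //= m IH.
have -> : iter m (t_climb (w x (last x q))) (Node (enc_unary x) (enc_seq enc_unary (x :: q))) =
          Node (enc_unary x) (enc_seq enc_unary (x :: q)).
  by elim: m {IH} => //= m ->; rewrite /t_climb /= teq_unary eqxx.
by rewrite /t_climb /= teq_unary eqxx.
Qed.

End Walk.

(** * The target graph *)

Lemma sumn_iota m (f : nat -> nat) : sumn [seq f i | i <- iota 0 m] = \sum_(i < m) f i.
Proof. by rewrite sumnE big_map -{1}[m]subn0 -/(index_iota 0 m) big_mkord. Qed.

Ltac absurd_nat := intros; exfalso; lia.

Section GadgetEdges.
Variables (directed : bool) (I : vdp_inst).
Hypothesis instI : vdp_is_inst directed I.
Local Notation n := (vdp_n I).
Local Notation p := (size (vdp_pairs I)).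
Local Notation q := (size (owners I)).
Local Notation last_snk := (snk I p.-1).

Lemma pairs_gt0 : 0 < p. Proof. by case: instI. Qed.
Lemma last_pair : p.-1 < p. Proof. by rewrite ltn_predL pairs_gt0. Qed.

Lemma src_nth i (u : 'I_n * 'I_n) : i < p -> src I i = (nth u (vdp_pairs I) i).1.
Proof. by move=> lt; rewrite /src (nth_map u). Qed.

Lemma snk_nth i (u : 'I_n * 'I_n) : i < p -> snk I i = (nth u (vdp_pairs I) i).2.
Proof. by move=> lt; rewrite /snk (nth_map u). Qed.

Lemma pair0 : 'I_n * 'I_n.
Proof. by move: pairs_gt0; case: (vdp_pairs I). Qed.

Lemma src_lt i : i < p -> src I i < n.
Proof. by move=> /(src_nth pair0)->. Qed.

Lemma snk_lt i : i < p -> snk I i < n.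
Proof. by move=> /(snk_nth pair0)->. Qed.

Lemma uniq_src_snk : uniq (mkseq (src I) p ++ mkseq (snk I) p).
Proof.
have [_ _ _ _ u] := instI.
suff -> : mkseq (src I) p ++ mkseq (snk I) p =
    map val (unzip1 (vdp_pairs I) ++ unzip2 (vdp_pairs I)).
  by rewrite map_inj_uniq //; exact: val_inj.
rewrite map_cat -!map_comp; congr (_ ++ _).
  apply: (@eq_from_nth _ 0) => [|i]; rewrite size_mkseq ?size_map // => lt.
  by rewrite nth_mkseq // (nth_map pair0) // (src_nth pair0).
apply: (@eq_from_nth _ 0) => [|i]; rewrite size_mkseq ?size_map // => lt.
by rewrite nth_mkseq // (nth_map pair0) // (snk_nth pair0).
Qed.

Lemma src_inj i j : i < p -> j < p -> src I i = src I j -> i = j.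
Proof.
have := uniq_src_snk; rewrite cat_uniq => /and3P[/(mkseq_uniqP _ _) h _ _] li lj.
by apply: h; rewrite inE.
Qed.

Lemma snk_inj i j : i < p -> j < p -> snk I i = snk I j -> i = j.
Proof.
have := uniq_src_snk; rewrite cat_uniq => /and3P[_ _ /(mkseq_uniqP _ _) h] li lj.
by apply: h; rewrite inE.
Qed.

Lemma src_neq_snk i j : i < p -> j < p -> src I i <> snk I j.
Proof.
have := uniq_src_snk; rewrite cat_uniq => /and3P[_ /hasPn h _] li lj e.
have /h/negP : snk I j \in mkseq (snk I) p by apply: map_f; rewrite mem_iota.
by apply; rewrite /= -e; apply: map_f; rewrite mem_iota.
Qed.

Lemma size_rows : size (rows I) = n.
Proof. by rewrite size_map size_enum_ord. Qed.

Lemma old_ord (x y : 'I_n) : old I x y = if vdp_edge x y then Some (vdp_len x y) else None.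
Proof.
rewrite /old (nth_map x) ?size_enum_ord // (nth_map y) ?size_enum_ord //.
by rewrite !nth_ord_enum.
Qed.

Lemma old_lt x y w : old I x y = Some w -> x < n /\ y < n.
Proof.
rewrite /old; have [lt|le] := ltnP x n; last first.
  by rewrite (@nth_default _ _ (rows I)) ?size_rows ?nth_nil.
pose x' := Ordinal lt; rewrite (nth_map x') ?size_enum_ord //.
have [//|le] := ltnP y n; rewrite nth_default // size_map size_enum_ord //.
Qed.

Lemma owners_snk k : k < q -> exists2 j, j < p & nth 0 (owners I) k = snk I j.
Proof.
move=> /(mem_nth 0)/flattenP[s /mapP[j]]; rewrite mem_iota => /andP[_ lt] ->.
by rewrite mem_nseq => /andP[_ /eqP->]; exists j.
Qed.

Lemma count_owners j : j < p -> count_mem (snk I j) (owners I) = j.+1.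
Proof.
move=> lt; rewrite /owners count_flatten -map_comp sumn_iota (bigD1 (Ordinal lt)) //=.
rewrite count_nseq /= eqxx mul1n big1 ?addn0 // => i ne.
rewrite count_nseq /=; case: eqP => // e; case/eqP: ne; apply: val_inj => /=.
exact: snk_inj e.
Qed.

Lemma size_owners : q = (p * p.+1)./2.
Proof.
rewrite /owners size_flatten /shape -map_comp sumn_iota.
rewrite (eq_bigr (fun i : 'I_p => i.+1)); last by move=> i _ /=; rewrite size_nseq.
by have := bin2_sum p.+1; rewrite big_mkord big_ord_recl add0n bin2 mulnC.
Qed.

Variant new_spec x y : rat * nat -> Prop :=
| NewSource i of i < p & x = n & y = src I i : new_spec x y (0%R, i.+1)
| NewTerminal k of k < q & x = nth 0 (owners I) k & y = n + k.+1 : new_spec x y (0%R, 1)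
| NewSink of x = last_snk & y <= n : new_spec x y (big_len I, 1).

Lemma new_edgesP x y c : reflect (new_spec x y c) (((x, y), c) \in new_edges I).
Proof.
rewrite /new_edges !mem_cat; apply: (iffP or3P) => [[]/mapP[i]|[]].
- by rewrite mem_iota => /= lt [-> -> ->]; apply: NewSource lt _ _.
- by rewrite mem_iota => /= lt [-> -> ->]; apply: NewTerminal lt _ _.
- by rewrite mem_iota => /= lt [-> -> ->]; apply: NewSink.
- by move=> i lt -> ->; constructor 1; apply/mapP; exists i; rewrite ?mem_iota.
- by move=> k lt -> ->; constructor 2; apply/mapP; exists k; rewrite ?mem_iota.
- by move=> -> lt; constructor 3; apply/mapP; exists y; rewrite ?mem_iota.
Qed.

Lemma look_spec x y c : look I x y = Some c -> new_spec x y c.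
Proof.
rewrite /look; case E: (map _ _) => [|c' s] //= -[<-].
have : c' \in c' :: s by rewrite inE eqxx.
rewrite -E => /mapP[[xy c'']]; rewrite mem_filter => /= /andP[/eqP-> m] ->.
exact/new_edgesP.
Qed.

Lemma look_None x y c : look I x y = None -> ~ new_spec x y c.
Proof.
rewrite /look => h /new_edgesP m.
suff : c \in [seq u.2 | u <- new_edges I & u.1 == (x, y)] by case: (map _ _) h.
by apply/mapP; exists (x, y, c) => //; rewrite mem_filter /= eqxx.
Qed.

Variant ent_spec x y : rat * nat -> Prop :=
| EntOld w of x <> y & old I x y = Some w : ent_spec x y (w, p)
| EntNew c of x <> y & old I x y = None & new_spec x y c : ent_spec x y c
| EntRev c of x <> y & old I x y = None & new_spec y x c : ent_spec x y c.

Lemma entP x y c : ent I x y = Some c -> ent_spec x y c.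
Proof.
rewrite /ent; case: eqP => // ne; case E: (old I x y) => [w|].
  by move=> [<-]; apply: EntOld.
case E': (look I x y) => [c'|]; first by move=> [<-]; apply: EntNew => //; exact: look_spec.
by move=> /look_spec; apply: EntRev.
Qed.

(** New edges with the same ends are of the same kind: only terminal edges have an end above [n],
    and star edges contain the last sink, which is not a source. So neither the order of the list
    nor the direction of lookup matters. *)
Lemma new_spec_fun x y c c' : x <> y ->
  new_spec x y c \/ new_spec y x c -> new_spec x y c' \/ new_spec y x c' -> c = c'.
Proof.
have term k : k < q -> nth 0 (owners I) k < n.
  by move=> /owners_snk[j lt ->]; exact: snk_lt.
have termsrc k i : k < q -> i < p -> nth 0 (owners I) k <> src I i.
  by move=> /owners_snk[j lt ->] li /esym; exact: src_neq_snk.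
have lt := snk_lt last_pair; have ss i (li : i < p) := src_neq_snk li last_pair.
move=> ne [] [i li|k lk|] e1 e2 [] [i' li'|k' lk'|] e1' e2' //;
  try (have := term _ lk); try (have := term _ lk');
  try (have := src_lt li); try (have := src_lt li');
  try (have := ss _ li); try (have := ss _ li');
  try (have := termsrc _ _ lk li'); try (have := termsrc _ _ lk' li); intros;
  try (exfalso; lia).
- by congr (_, _.+1); apply: src_inj => //; lia.
- by congr (_, _.+1); apply: src_inj => //; lia.
Qed.

Lemma owner_lt k : k < q -> nth 0 (owners I) k < n.
Proof. by move=> /owners_snk[j lt ->]; exact: snk_lt. Qed.

Lemma ent_new x y c : x <> y -> old I x y = None ->
  new_spec x y c \/ new_spec y x c -> ent I x y = Some c.
Proof.
move=> /[dup] ne /eqP/negPf ne' o h; rewrite /ent ne' o.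
case E: (look I x y) => [c'|].
  by congr Some; apply: new_spec_fun h => //; left; exact: look_spec.
case E': (look I y x) => [c'|].
  by congr Some; apply: new_spec_fun h => //; right; exact: look_spec.
by case: h => h; [case: (look_None E h)|case: (look_None E' h)].
Qed.

Lemma ent_old x y w : x <> y -> old I x y = Some w -> ent I x y = Some (w, p).
Proof. by rewrite /ent => /eqP/negPf-> ->. Qed.

Lemma old_geq x y : n <= x \/ n <= y -> old I x y = None.
Proof. by case E: (old I x y) => [w|] //; have := old_lt E; lia. Qed.

Lemma ent_src i : i < p -> ent I n (src I i) = Some (0%R, i.+1).
Proof.
move=> lt; apply: ent_new; first by have := src_lt lt; lia.
  by apply: old_geq; left.
by left; apply: NewSource lt _ _.
Qed.

Lemma ent_term k : k < q -> ent I (nth 0 (owners I) k) (n + k.+1) = Some (0%R, 1).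
Proof.
move=> lt; apply: ent_new; first by have := owner_lt lt; lia.
  by apply: old_geq; right; lia.
by left; apply: NewTerminal lt _ _.
Qed.

Lemma ent_into_term x k c : ent I x (n + k.+1) = Some c ->
  x = nth 0 (owners I) k /\ c = (0%R, 1).
Proof.
have lt := snk_lt last_pair.
case/entP => [w _ /old_lt|{}c _ _|{}c _ _]; first by absurd_nat.
  case=> [i /src_lt||]; [absurd_nat| |absurd_nat].
  by move=> k' _ -> e; split=> //; congr nth; lia.
by case=> [i _|k' /owner_lt|]; absurd_nat.
Qed.

Lemma ent_from_root y c : ent I n y = Some c ->
  (exists2 i, i < p & y = src I i) \/ y = last_snk.
Proof.
have lt := snk_lt last_pair.
case/entP => [w _ /old_lt|{}c _ _|{}c _ _]; first by absurd_nat.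
  by case=> [i li _ ->|k /owner_lt|]; [left; exists i|absurd_nat|absurd_nat].
by case=> [i /src_lt|k /owner_lt|->]; [absurd_nat|absurd_nat|right].
Qed.

(** A terminal edge has a sink as its old end, and a new edge between old vertices contains the last
    sink; leaving a non-sink, it must enter that sink. *)
Lemma ent_from_nonsink x y c : ent I x y = Some c -> x < n -> y <> n ->
  (forall j, j < p -> x <> snk I j) ->
  y < n /\ (old I x y = Some c.1 \/ y = last_snk /\ old I x y = None).
Proof.
move=> e lt ny nsnk; have ltl := snk_lt last_pair; case/entP: e.
- by move=> w _ /[dup] /old_lt[_ ?] ->; split; [|left].
- move=> {}c _ _; case=> [i _|k /owners_snk[j lj ->]|e]; first by absurd_nat.
    by move=> /(nsnk _ lj).
  by case/nsnk: e; exact: last_pair.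
- move=> {}c _ o; case=> [i _|k /owner_lt|e _]; [absurd_nat|absurd_nat|].
  by split; [lia|right].
Qed.

Lemma ent_into_last_snk x c : ent I x last_snk = Some c -> x <= n ->
  old I x last_snk = None -> c = (big_len I, 1).
Proof.
move=> e le o; have ltl := snk_lt last_pair; case/entP: e; first by rewrite o.
- move=> {}c _ _; case=> [i li _ /esym/src_neq_snk|k|] //; last by absurd_nat.
  by case; last exact: last_pair.
- by move=> {}c _ _; case=> [i _|k _ _|] //; absurd_nat.
Qed.

Lemma ent_last_snk x : x <= n -> x <> last_snk -> ent I last_snk x /\ ent I x last_snk.
Proof.
move=> le ne.
have H : new_spec last_snk x (big_len I, 1) by apply: NewSink.
split.
  case o: (old I last_snk x) => [w|]; first by rewrite (ent_old _ o) // => /esym.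
  by rewrite (ent_new _ o (or_introl H)) // => /esym.
case o: (old I x last_snk) => [w|]; first by rewrite (ent_old _ o).
by rewrite (ent_new _ o (or_intror H)).
Qed.

Lemma old_ge0 x y w : old I x y = Some w -> (0 <= w)%R.
Proof.
move=> /[dup] /old_lt[lx ly]; rewrite -[x]/(val (Ordinal lx)) -[y]/(val (Ordinal ly)).
by rewrite old_ord; case: ifP => // e [<-]; have [_ _ h _ _] := instI; exact: h.
Qed.

Lemma ent_ge0 x y c : ent I x y = Some c -> (0 <= c.1)%R.
Proof.
by case/entP => [w _ /old_ge0|{}c _ _ []|{}c _ _ []] *;
  rewrite ?Order.POrderTheory.lexx // Num.Theory.ler0n.
Qed.

Lemma ent_cap_gt0 x y c : ent I x y = Some c -> 0 < c.2.
Proof.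
by case/entP => [w _ _|{}c _ _ []|{}c _ _ []] //=; rewrite pairs_gt0.
Qed.

Lemma ent_sym : ~~ directed -> forall x y, ent I x y = ent I y x.
Proof.
move=> nd x y; have [[_ /(_ nd) se] /(_ nd) sw _ _ _] := instI.
have so a b : old I a b = old I b a.
  have [la|ga] := ltnP a n; last by rewrite !old_geq //; [right|left].
  have [lb|gb] := ltnP b n; last by rewrite !old_geq //; [left|right].
  rewrite -[a]/(val (Ordinal la)) -[b]/(val (Ordinal lb)) !old_ord se.
  by case: ifP => // e; rewrite sw // se.
rewrite /ent eq_sym so; case: eqP => // ne; case: (old I y x) => //.
case E: (look I x y) => [c|]; case E': (look I y x) => [c'|] //.
congr Some; apply: (new_spec_fun (not_eq_sym ne)).
  by left; exact: look_spec.
by right; exact: look_spec.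
Qed.

Lemma reduction_inst : cst_is_inst directed (reduction I).
Proof.
have rootE : val (cst_root (reduction I)) = n by rewrite /= inordK // ltnS leq_addr.
have conn x : connect (@cst_edge (reduction I)) (cst_root (reduction I)) x.
  have ltl := snk_lt last_pair.
  have eS : @cst_edge (reduction I) (cst_root (reduction I)) (inord last_snk).
    rewrite /= inordK ?inordK ?ltnS ?leq_addr //; last by lia.
    by case: (@ent_last_snk n _ _) => //; lia.
  have cS y : val y <= n -> connect (@cst_edge (reduction I)) (cst_root (reduction I)) y.
    move=> le; apply: connect_trans (connect1 eS) _.
    have [e|ne] := eqVneq (val y) last_snk.
      by rewrite (_ : inord _ = y) //; apply: val_inj; rewrite /= -e inord_val.
    apply: connect1; rewrite /= inordK; last by lia.
    by case: (@ent_last_snk (val y) le (elimN eqP ne)).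
  have [le|gt] := leqP x n; first exact: cS.
  have lk : x - n.+1 < q by have := ltn_ord x; move: gt => /=; lia.
  have lo := owner_lt lk; set o := nth _ _ _ in lo.
  have oE : val (inord o : 'I_(n + q).+1) = o by rewrite /= inordK // ltnS ltnW // ltn_addr.
  apply: connect_trans (cS (inord o) _) _; first by rewrite oE ltnW.
  apply: connect1; rewrite /cst_edge /= -[nat_of_ord (inord o)]/(val _) oE.
  by have := ent_term lk; rewrite -/o (_ : n + _ = x) => [->//|]; lia.
split.
- split; last 2 first.
  + by move=> nd x y _; rewrite /= ent_sym.
  + by move=> nd x y _; rewrite /= ent_sym.
  + by split=> [x|nd x y] /=; [rewrite /ent eqxx|rewrite ent_sym].
- case d: directed => // x y.
  have cs : connect_sym (@cst_edge (reduction I)).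
    by apply: sym_connect_sym => a b; rewrite /= ent_sym ?d.
  by apply: connect_trans (conn y); rewrite cs.
- by move=> x y /=; case E: (ent I x y) => [c|] //= _; apply: ent_ge0 E.
- by move=> x y /=; case E: (ent I x y) => [c|] //= _; apply: ent_cap_gt0 E.
split.
  rewrite card_gt0; apply/set0Pn; exists ord_max; rewrite inE /=.
  by rewrite -{1}[n]addn0 ltn_add2l size_owners; have := pairs_gt0; case: (size _) => // -[].
by rewrite inE rootE ltnn.
Qed.

Lemma card_term : #|cst_term (reduction I)| = (p * p.+1)./2.
Proof.
by rewrite -size_owners cardE -(size_map val) enum_term size_iota.
Qed.

End GadgetEdges.

(** * Paths from a Steiner tree *)

Section Arborescence.
Variables (N : nat) (r : 'I_N) (S : {set 'I_N * 'I_N}).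
Hypothesis arbS : is_arborescence r S.

Lemma connect_arcl x y : connect (arc_rel S) x y -> x <> y ->
  exists2 z, (x, z) \in S & connect (arc_rel S) z y.
Proof.
case/connectP=> -[|z s] /=; first by move=> _ ->.
by move=> /andP[xz pz] -> _; exists z => //; apply/connectP; exists s.
Qed.

Lemma connect_arcr x y : connect (arc_rel S) x y -> x <> y ->
  exists2 z, connect (arc_rel S) x z & (z, y) \in S.
Proof.
case/connectP=> s; case/lastP: s => [|s z]; first by move=> _ ->.
rewrite rcons_path last_rcons => /andP[ps sz] -> _.
by exists (last x s) => //; apply/connectP; exists s.
Qed.

Lemma connect_root x : connect (arc_rel S) x r -> x = r.
Proof.
move=> c; apply/eqP/negPn/negP => /eqP ne.
have [z _ zr] := connect_arcr c ne.
by case: arbS => /(_ _ zr) /=; rewrite eqxx.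
Qed.

(** Entering arcs are unique, so going back from [z] there is only one way, and both ancestors lie
    on it. *)
Lemma connect_chain x y z : connect (arc_rel S) x z -> connect (arc_rel S) y z ->
  connect (arc_rel S) x y \/ connect (arc_rel S) y x.
Proof.
have [_ uS _] := arbS.
case/connectP=> s; elim/last_ind: s z => [|s w IH] z.
  by move=> _ -> c; right.
rewrite rcons_path last_rcons => /andP[ps sw] ->{z} c.
have [->|ne] := eqVneq y w.
  left; apply/connectP; exists (rcons s w); last by rewrite last_rcons.
  by rewrite rcons_path ps.
have [z cz zw] := connect_arcr c (elimN eqP ne).
by apply: (IH z) => //; case: (uS _ _ zw sw erefl).
Qed.

Lemma tree_vertex_arc x : x \in tree_vertices r S -> x <> r -> exists y, (y, x) \in S.
Proof.
have [_ _ cS] := arbS => /cS c ne.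
by have [y _ ?] := connect_arcr c (not_eq_sym ne); exists y.
Qed.

Lemma connect_arc a : a \in S -> connect (arc_rel S) r a.1.
Proof.
have [_ _ cS] := arbS => aS; apply: cS.
by rewrite !inE; apply/orP; left; apply/orP; right; apply/imsetP; exists a.
Qed.

End Arborescence.

Lemma uniq_flatten (T : eqType) (ss : seq (seq T)) : all uniq ss ->
  pairwise (fun s s' : seq T => ~~ has (mem s) s') ss -> uniq (flatten ss).
Proof.
elim: ss => //= s ss IH /andP[us uss] /andP[ds dss].
rewrite cat_uniq us IH // andbT; apply/hasPn => x /flattenP[s' s'ss xs'].
by move/allP: ds => /(_ _ s'ss)/hasPn/(_ _ xs').
Qed.

Lemma subseq_behead (T : eqType) (ss : seq (seq T)) :
  subseq (flatten (map behead ss)) (flatten ss).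
Proof.
elim: ss => //= s ss IH; apply: cat_subseq => //.
by case: s => //= x s; exact: subseq_cons.
Qed.

Section PathsOfTree.
Variables (directed : bool) (I : vdp_inst).
Hypothesis instI : vdp_is_inst directed I.
Local Notation n := (vdp_n I).
Local Notation p := (size (vdp_pairs I)).
Local Notation q := (size (owners I)).
Local Notation N := (n + q).+1.
Local Notation last_snk := (snk I p.-1).

(** Terminal [x] has rank [x - n.+1] in [owners], so cardinals of sets of terminals become counts in
    a list. *)
Lemma card_group (P : pred nat) :
  #|[set x : 'I_N | (n < x) && P (nth 0 (owners I) (x - n.+1))]| = count P (owners I).
Proof.
rewrite cardE (_ : enum _ =
  [seq x <- enum (cst_term (reduction I)) | P (nth 0 (owners I) (val x - n.+1))]).
  rewrite size_filter -(count_map val (fun k => P (nth 0 (owners I) (k - n.+1)))) enum_term.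
  rewrite -[in RHS](mkseq_nth 0 (owners I)) /mkseq.
  rewrite (_ : iota n.+1 q = [seq n.+1 + k | k <- iota 0 q]) ?count_map; last first.
    by rewrite -iotaDl addn0.
  by apply: eq_count => k /=; rewrite addKn.
rewrite {2}/enum_mem -filter_predI; apply: eq_filter => x; by rewrite !inE andbC.
Qed.

Definition old_vertex (x : 'I_n) : 'I_N := inord (val x).
Local Notation up := old_vertex.

Lemma val_inord k : k < n -> val (inord k : 'I_N) = k.
Proof. by move=> lt; rewrite /= inordK // ltnS ltnW // ltn_addr. Qed.

Lemma val_up (x : 'I_n) : val (up x) = val x.
Proof. exact: val_inord (ltn_ord x). Qed.

Lemma up_inj : injective up.
Proof. by move=> x y /(congr1 val); rewrite !val_up => /val_inj. Qed.

Definition path_arcs (mu : seq (seq 'I_n)) : seq ('I_N * 'I_N) :=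
  flatten [seq [seq (up a.1, up a.2) | a <- zip m (behead m)] | m <- mu].

Lemma unzip2_path_arcs mu : unzip2 (path_arcs mu) = map up (flatten (map behead mu)).
Proof.
rewrite /unzip2 /path_arcs !map_flatten -!map_comp; congr flatten; apply: eq_map => m /=.
rewrite -map_comp -[in RHS](@unzip2_zip _ _ m (behead m)) ?size_behead ?leq_pred //.
by rewrite /unzip2 -map_comp.
Qed.

Lemma path_arcsP mu a : reflect
  (exists2 m, m \in mu & exists2 b, b \in zip m (behead m) & a = (up b.1, up b.2))
  (a \in path_arcs mu).
Proof.
apply: (iffP flattenP) => [[s /mapP[m mm ->] /mapP[b bm ->]]|[m mm [b bm ->]]].
  by exists m => //; exists b.
by exists [seq (up a.1, up a.2) | a <- zip m (behead m)]; apply: map_f.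
Qed.

Lemma mem_sol (mu : vdp_sol I) m : vdp_is_sol mu -> m \in mu ->
  exists2 st, st \in vdp_pairs I & path_links (@vdp_edge I) st m.
Proof.
case=> + _; elim: (vdp_pairs I) mu => [|st s IH] [|m' mu] //= /andP[l /IH{}IH].
rewrite inE => /predU1P[->|/IH[st' st's l']]; first by exists st; rewrite ?inE ?eqxx.
by exists st'; rewrite // inE st's orbT.
Qed.

Lemma sol_uniq (mu : vdp_sol I) : vdp_is_sol mu -> uniq (flatten mu).
Proof.
move=> sol; apply: uniq_flatten; last by case: sol.
by apply/allP => m /(mem_sol sol)[st _]; case: m => // x s /and4P[].
Qed.

Lemma sol_edge (mu : vdp_sol I) m a : vdp_is_sol mu -> m \in mu ->
  a \in zip m (behead m) -> vdp_edge a.1 a.2.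
Proof.
move=> sol /(mem_sol sol)[st _]; case: m => //= x s /and4P[_ _ + _].
elim: s x => //= y s IH x /andP[xy ps]; rewrite inE => /predU1P[->//|].
exact: IH.
Qed.

Lemma uniq_path_arcs mu : vdp_is_sol mu -> uniq (unzip2 (path_arcs mu)).
Proof.
move=> sol; rewrite unzip2_path_arcs (map_inj_uniq up_inj).
exact: subseq_uniq (subseq_behead _) (sol_uniq sol).
Qed.

Lemma ent_edge (x y : 'I_n) : vdp_edge x y ->
  ent I (val (up x)) (val (up y)) = Some (vdp_len x y, p).
Proof.
move=> e; rewrite !val_up; apply: ent_old; last by rewrite old_ord e.
by case: instI => -[irr _] _ _ _ _ /val_inj eq; rewrite eq irr in e.
Qed.

Lemma cost_path_arcs (mu : vdp_sol I) : vdp_is_sol mu ->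
  (\sum_(a <- path_arcs mu) @cst_len (reduction I) a.1 a.2)%R = vdp_cost mu.
Proof.
move=> sol; rewrite /path_arcs big_flatten big_map /vdp_cost.
apply: eq_big_seq => m mm; rewrite big_map /path_length.
by apply: eq_big_seq => a am; rewrite /= (ent_edge (sol_edge sol mm am)).
Qed.

Variable S : {set 'I_N * 'I_N}.
Hypothesis solS : cst_is_sol (I := reduction I) S.
(** No star edge enters the last sink. This is assumed here because its proof depends on whether [p]
    is 1, and nothing else does. *)
Hypothesis old_into_last : forall a, a \in S ->
  val a.2 = last_snk -> val a.1 <= n -> old I (val a.1) (val a.2) <> None.

Local Notation r := (inord n : 'I_N).
Local Notation src_ i := (inord (src I i) : 'I_N).
Local Notation snk_ i := (inord (snk I i) : 'I_N).

Let arbS : is_arborescence r S. Proof. by case: solS. Qed.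

Lemma val_root : val r = n. Proof. by rewrite /= inordK // ltnS leq_addr. Qed.

Lemma arc_ent a : a \in S -> exists c, ent I (val a.1) (val a.2) = Some c.
Proof.
move=> aS; case: solS => /(_ _ aS) /=; case: (ent I _ _) => // c _ _ _ _.
by exists c.
Qed.

Lemma term_arc (t : 'I_N) : n < t -> (inord (nth 0 (owners I) (t - n.+1)), t) \in S.
Proof.
move=> lt; case: solS => _ _ /subsetP/(_ t) tS _.
have tr : t <> r by move/(congr1 val); rewrite val_root => e; rewrite e ltnn in lt.
have [|y yt] := tree_vertex_arc arbS _ tr; first by apply: tS; rewrite inE.
have [c] := arc_ent yt.
have -> : val t = n + (val t - n.+1).+1 by move: lt => /=; lia.
by move=> /(ent_into_term instI)[e _]; rewrite -e inord_val.
Qed.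

(** Some terminal hangs on the sink, which is its only possible parent. The branch of the root that
    contains it starts at a source, since a first arc to the last sink would be a star edge. *)
Lemma root_to_snk j : j < p ->
  exists2 i, i < p & (r, src_ i) \in S /\ connect (arc_rel S) (src_ i) (snk_ j).
Proof.
move=> lj.
have : 0 < count_mem (snk I j) (owners I) by rewrite (count_owners instI).
rewrite -has_count => /hasP[s /(nthP 0)[k lk] e /eqP es]; rewrite {s}es in e.
have ltk : n + k.+1 < N by rewrite ltnS leq_add2l.
have := @term_arc (inord (n + k.+1)).
rewrite inordK // addnS -addSn addKn e => /(_ (leq_addr _ _)) aS.
have [|y ry c] := connect_arcl (connect_arc arbS aS).
  move=> /(congr1 val); rewrite val_root val_inord ?(snk_lt instI) //.
  by have := snk_lt instI lj; lia.
have [w] := arc_ent ry; rewrite val_root.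
case/(ent_from_root instI) => [[i li ey]|ey].
  by exists i => //; rewrite -ey inord_val.
case: (old_into_last ry) => //=; first by rewrite inordK // ltnS leq_addr.
by apply: old_geq; left; rewrite inordK // ltnS leq_addr.
Qed.

(** Terminals lie below their sinks, so every sink under [src_ i] charges all its terminals to the
    capacity [i.+1]. *)
Lemma cap_src i (P : pred nat) : i < p -> (r, src_ i) \in S ->
  (forall j, j < p -> P (snk I j) -> connect (arc_rel S) (src_ i) (snk_ j)) ->
  count P (owners I) <= i.+1.
Proof.
move=> li rS cP; case: solS => _ _ _ /(_ _ rS).
rewrite /= val_root val_inord ?(src_lt instI) // (ent_src instI) //=.
apply: leq_trans; rewrite -card_group; apply: subset_leq_card; apply/subsetP => x.
rewrite !inE => /andP[lt Px]; rewrite lt /=.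
have := term_arc lt; have [|j lj e] := @owners_snk I (x - n.+1).
  by have := ltn_ord x; lia.
rewrite e in Px *; move=> arc; apply: connect_trans (cP _ lj Px) (connect1 arc).
Qed.

Lemma src_to_snk j : j < p -> (r, src_ j) \in S /\ connect (arc_rel S) (src_ j) (snk_ j).
Proof.
have [m] := ubnP (p - j); elim: m j => // m IH j lem lj.
have [i li [rS c]] := root_to_snk lj.
have : j <= i.
  rewrite -ltnS -(count_owners instI lj); apply: (cap_src li rS) => j' lj' /eqP.
  by move/(snk_inj instI lj' lj)->.
rewrite leq_eqVlt => /predU1P[e|ltji]; first by subst j.
have lti : p - i < m by lia.
have [_ c'] := IH i lti li.
(* If [j < i], the induction hypothesis puts sink [i] below [src_ i] along with sink [j], hence
   [j.+1 + i.+1] terminals under a capacity of [i.+1]. *)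
have := count_predUI (pred1 (snk I j)) (pred1 (snk I i)) (owners I).
rewrite !(count_owners instI) // (_ : count (predI _ _) _ = 0); last first.
  apply/eqP; rewrite -leqn0 leqNgt -has_count; apply/hasPn => x _ /=.
  by apply/negP => /andP[/eqP-> /eqP/(snk_inj instI lj li)]; lia.
have : count (predU (pred1 (snk I j)) (pred1 (snk I i))) (owners I) <= i.+1.
  apply: (cap_src li rS) => j' lj' /orP[]/eqP.
    by move/(snk_inj instI lj' lj)->.
  by move/(snk_inj instI lj' li)->.
by move=> *; exfalso; lia.
Qed.

(** Overlapping subtrees have comparable roots. If [src_ j] were properly below [src_ i], so would
    be the tail of its entering arc or that tail would be [src_ i]; but it is [r], which no arc
    enters. *)
Lemma src_disjoint i j x : i < p -> j < p ->
  connect (arc_rel S) (src_ i) x -> connect (arc_rel S) (src_ j) x -> i = j.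
Proof.
wlog : i j / connect (arc_rel S) (src_ i) (src_ j).
  move=> H li lj ci cj; case: (connect_chain arbS ci cj) => c; first exact: H.
  by symmetry; apply: H.
move=> c li lj _ _.
apply: (src_inj instI) => //.
have [e|/eqP ne] := eqVneq (src_ i) (src_ j).
  by rewrite -(val_inord (src_lt instI li)) e val_inord ?(src_lt instI).
have [z cz zj] := connect_arcr c ne.
have [rj _] := src_to_snk lj.
have ez : z = r by case: arbS => _ /(_ _ _ zj rj erefl)[].
have := connect_root arbS; rewrite -ez => /(_ _ cz)/(congr1 val).
by rewrite ez val_root val_inord ?(src_lt instI) //; have := src_lt instI li; lia.
Qed.

Lemma path_old i (x : 'I_N) s : i < p -> path (arc_rel S) x s -> uniq (x :: s) ->
  connect (arc_rel S) (src_ i) x -> last x s = snk_ i -> x < n ->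
  all (fun y : 'I_N => y < n) s /\
  path (fun a b : 'I_N => old I a b : bool) x s.
Proof.
move=> li; elim: s x => //= y s IH x /andP[xy py] /andP[xns us] cx ls ltx.
(* A sink on the path lies below its own source, so disjointness makes it sink [i], the end of the
   path; [x] comes before the end and vertices do not repeat. *)
have nsnk j : j < p -> val x <> snk I j.
  move=> lj e; have ex : x = snk_ j by rewrite -e inord_val.
  have [_ cj] := src_to_snk lj; rewrite -ex in cj.
  have eij := src_disjoint li lj cx cj.
  by move: xns; rewrite ex -eij -ls mem_last.
have yr : val y <> n.
  case: arbS => /(_ _ xy)/= /eqP ne _ _ e; apply: ne.
  by apply: val_inj; rewrite val_root.
have [c] := arc_ent xy => /= e.
have [lty [o|[ey o]]] := ent_from_nonsink instI e ltx yr nsnk; last first.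
  by case: (old_into_last xy ey (ltnW ltx)).
rewrite lty o; apply: (IH y) => //.
exact: connect_trans cx (connect1 xy).
Qed.

Lemma extract_path (st : 'I_n * 'I_n) i : i < p -> val st.1 = src I i -> val st.2 = snk I i ->
  exists s : seq 'I_n,
  [/\ path_links (@vdp_edge I) st (st.1 :: s),
      path (fun a b => (up a, up b) \in S) st.1 s &
      forall x, x \in st.1 :: s -> connect (arc_rel S) (src_ i) (up x)].
Proof.
move=> li e1 e2; have [_ /connectP[s0 p0 l0]] := src_to_snk li.
case/shortenP: p0 l0 => s ps us _ ls.
have [|al po] := path_old li ps us (connect0 _ _) (esym ls).
  by rewrite -[nat_of_ord _]/(val _) val_inord ?(src_lt instI).
(* All vertices of [s] are below [n], so [insubd] inverts [up] on them and never falls back on its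
   default. *)
have es : map up (map (fun y : 'I_N => insubd st.1 (val y)) s) = s.
  rewrite -map_comp -[RHS]map_id; apply/eq_in_map => y /(allP al) lt.
  by apply: val_inj; rewrite /= val_up val_insubd lt.
exists (map (fun y : 'I_N => insubd st.1 (val y)) s).
move: es; set s' := map _ s => es; rewrite -e1 -/(up st.1) -es in ps us ls po *.
rewrite !path_map in ps po.
split => //=.
- rewrite eqxx /=; apply/and3P; split.
  + apply/eqP/up_inj; rewrite -last_map -ls; congr inord; exact: esym.
  + apply: sub_path po => a b /=.
    by rewrite -[nat_of_ord (up a)]/(val _) -[nat_of_ord (up b)]/(val _) !val_up old_ord; case: ifP.
  + by rewrite -[_ && _]/(uniq (st.1 :: s')) -(map_inj_uniq up_inj).
- move=> x xs; apply: (@path_connect _ (arc_rel S) (up st.1) (map up s')).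
    by rewrite path_map.
  by rewrite -map_cons map_f.
Qed.

Definition nat_arcs : seq (nat * nat) := [seq (val a.1, val a.2) | a <- enum S].

Lemma uniq_nat_arcs : uniq (unzip2 nat_arcs).
Proof.
rewrite /unzip2 -map_comp map_inj_in_uniq ?enum_uniq // => a b.
rewrite !mem_enum => aS bS /val_inj; case: arbS => _ u _; exact: u.
Qed.

(** The paths come from connectivity; they coincide with what the program computes because the climb
    follows unique entering arcs. The last clause is kept for comparing costs. *)
Lemma extract_paths : exists mu : vdp_sol I,
  [/\ vdp_is_sol mu,
      vdp_enc_sol mu = t_extract (Node (vdp_enc_inst I) (cst_enc_sol (I := reduction I) S)) &
      forall m a, m \in mu -> a \in zip m (behead m) -> (up a.1, up a.2) \in S].
Proof.
pose st (i : 'I_p) := nth (pair0 instI) (vdp_pairs I) i.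
have /fin_all_exists[g gP] (i : 'I_p) := @extract_path (st i) i (ltn_ord i)
  (esym (src_nth _ (ltn_ord i))) (esym (snk_nth _ (ltn_ord i))).
have epairs : vdp_pairs I = map st (enum 'I_p).
  by rewrite /st (map_comp (nth _ _) val) val_enum_ord map_nth_iota0 // take_size.
pose mu := [seq (st i).1 :: g i | i <- enum 'I_p].
exists mu; split.
- split.
    rewrite {1}epairs /mu; elim: (enum _) => //= i s ->; rewrite andbT.
    by have [] := gP i.
  rewrite pairwise_map; apply: (@sub_pairwise _ [rel x y | x != y]); last first.
    by rewrite -uniq_pairwise enum_uniq.
  move=> i j ne; apply/hasPn => x xj; apply/negP => xi; case/eqP: (ne : i != j).
  have [_ _ /(_ _ xi) ci] := gP i; have [_ _ /(_ _ xj) cj] := gP j.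
  by apply: val_inj; exact: src_disjoint ci cj.
- rewrite /t_extract /= /vdp_enc_sol {1}epairs /mu tmap_enc !enc_seq_map.
  apply: eq_enc_seq => i.
  have -> : cst_enc_sol (I := reduction I) S = enc_seq (enc_pair enc_unary enc_unary) nat_arcs.
    by rewrite enc_seq_map.
  have [/and3P[_ /eqP l /andP[_ u]] pS _] := gP i.
  rewrite -(enc_seq_map enc_unary val).
  rewrite -(@t_walkE _ uniq_nat_arcs) /=.
  + by rewrite last_map l.
  + rewrite path_map; apply: sub_path pS => a b /= abS.
    by apply/mapP; exists (up a, up b); rewrite ?mem_enum //= -!/(val _) !val_up.
  + by rewrite -[_ && _]/(uniq (map val ((st i).1 :: g i))) map_inj_uniq //; exact: val_inj.
- move=> m a /mapP[i _ ->] /=; have [_ pS _] := gP i.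
  elim: (g i) (st i).1 pS => //= y s IH x /andP[xy ps].
  by rewrite inE => /predU1P[->|]; [|exact: IH].
Qed.

(** The arcs of the paths are distinct arcs of [S], and the other arcs of [S] have nonnegative
    length. *)
Lemma cost_extract (mu : vdp_sol I) : vdp_is_sol mu ->
  (forall m a, m \in mu -> a \in zip m (behead m) -> (up a.1, up a.2) \in S) ->
  (vdp_cost mu <= cst_cost (I := reduction I) S)%R.
Proof.
move=> sol sub; rewrite -(cost_path_arcs sol) /cst_cost big_uniq /=; last first.
  exact: map_uniq (uniq_path_arcs sol).
rewrite [leRHS](bigID (mem (path_arcs mu))) /= big_mkcond [in leRHS]big_mkcond /=.
rewrite (eq_bigr (fun a => if (a \in S) && (a \in path_arcs mu) then
   @cst_len (reduction I) a.1 a.2 else 0)%R).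
  rewrite lerDl sumr_ge0 // => a /andP[aS _] /=.
  by have [c e] := arc_ent aS; rewrite e; exact: ent_ge0 instI _ _ _ e.
move=> a _; case: ifP; last by rewrite andbF.
by move=> /path_arcsP[m mm [b bm ->]]; rewrite (sub _ _ mm bm).
Qed.

End PathsOfTree.

(** * A Steiner tree from paths *)

Lemma ltn_bitlen m : m < 2 ^ bitlen m.
Proof.
rewrite /bitlen /enc_binary -{1}[m]bin_of_natK; case: (bin_of_nat m) => //= b.
elim: b => //= b IH; rewrite NatTrec.doubleE expnS mul2n ?ltn_double //.
by rewrite -doubleS leq_double.
Qed.

(** If [a < u] and [b < v] then [a + b < (a + 1) * (b + 1) <= u * v]. *)
Lemma sum_ltn_exp2 (T : Type) (s : seq T) (a b : T -> nat) :
  (forall x, a x < 2 ^ b x) -> \sum_(x <- s) a x < 2 ^ sumn (map b s).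
Proof.
move=> h; elim: s => [|x s IH]; first by rewrite big_nil.
rewrite big_cons /= expnD; have := h x; move: IH.
set u := \sum_(_ <- _) _; set v := 2 ^ sumn _; set w := 2 ^ b x; nia.
Qed.

Lemma rat_le_num (w : rat) : (0 <= w)%R -> (w <= `|numq w|%N%:R)%R.
Proof.
move=> w0; rewrite -{1}[w]divq_num_den ler_pdivrMr ?ltr0z //.
rewrite natr_absz ger0_norm ?numq_ge0 // ler_peMr ?ler0z ?numq_ge0 //.
by rewrite ler1z -gtz0_ge1.
Qed.

Lemma map_uniq_inj (T T' : eqType) (f : T -> T') s :
  uniq (map f s) -> {in s &, injective f}.
Proof.
elim: s => //= z s IH /andP[nz us] x y; rewrite !inE.
move=> /predU1P[->|xs] /predU1P[->|ys] // e; last exact: IH.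
  by rewrite e map_f in nz.
by rewrite -e map_f in nz.
Qed.

Lemma zip_behead_mem (T : eqType) (m : seq T) b :
  b \in zip m (behead m) -> b.1 \in m /\ b.2 \in m.
Proof.
case: m => // x s; elim: s x => //= y s IH x.
rewrite inE => /predU1P[->|/IH[]] /=; first by rewrite !inE !eqxx orbT.
by rewrite [b.1 \in _ :: _]inE [b.2 \in x :: _]inE => -> ->; rewrite !orbT.
Qed.

Lemma connect_closed (T : finType) (e : rel T) (C : {set T}) x y :
  (forall a b, e a b -> a \in C -> b \in C) -> connect e x y -> x \in C -> y \in C.
Proof.
move=> cl /connectP[s ps ->]; elim: s x ps => //= z s IH x /andP[xz ps] xC.
by apply: IH ps _; exact: cl xz xC.
Qed.

Section TreeOfPaths.
Variables (directed : bool) (I : vdp_inst).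
Hypothesis instI : vdp_is_inst directed I.
Local Notation n := (vdp_n I).
Local Notation p := (size (vdp_pairs I)).
Local Notation q := (size (owners I)).
Local Notation N := (n + q).+1.
Local Notation r := (inord n : 'I_N).
Local Notation up := (@old_vertex I).

Variable mu : vdp_sol I.
Hypothesis solmu : vdp_is_sol mu.

(** Disjoint simple paths use each arc at most once, so the cost is at most the sum of the
    numerators over the whole matrix. *)
Lemma cost_lt_big : (vdp_cost mu < big_len I)%R.
Proof.
pose L := flatten [seq zip m (behead m) | m <- mu].
pose num (o : option rat) := if o is Some w then `|numq w|%N else 0.
have uL : uniq L.
  have := map_uniq (uniq_path_arcs solmu); rewrite /path_arcs => u.
  apply: (@map_uniq _ _ (fun a => (up a.1, up a.2))).
  by rewrite map_flatten -map_comp.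
have lt : \sum_(x <- rows I) \sum_(o <- x) num o < 2 ^ bits I.
  rewrite /bits; apply: sum_ltn_exp2 => x; apply: sum_ltn_exp2 => -[w|] //=.
  exact: ltn_bitlen.
apply: (@le_lt_trans _ _ (\sum_(x <- rows I) \sum_(o <- x) num o)%:R%R); last first.
  by rewrite ltr_nat.
rewrite /rows big_map.
under [X in (_ <= X%:R)%R]eq_bigr => x _ do rewrite big_map.
rewrite !big_enum /= (eq_bigr (fun x => \sum_(y : 'I_n)
  num (if vdp_edge x y then Some (vdp_len x y) else None))); last first.
  by move=> x _; rewrite big_enum.
rewrite pair_big /= natr_sum.
have -> : vdp_cost mu = (\sum_(a <- L) vdp_len a.1 a.2)%R.
  by rewrite big_flatten big_map.
rewrite big_uniq //= [leRHS](bigID (mem L)) /=.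
apply: ler_wpDr; first by apply: sumr_ge0 => a _; rewrite ler0n.
apply: ler_sum => a /flattenP[s /mapP[m mm ->] am].
rewrite (sol_edge solmu mm am); apply: rat_le_num.
by case: instI => _ _ h _ _; apply: h; exact: (sol_edge solmu mm am).
Qed.

Definition source_arcs : seq ('I_N * 'I_N) := [seq (r, up st.1) | st <- vdp_pairs I].
Definition term_arcs : seq ('I_N * 'I_N) :=
  [seq (inord (nth 0 (owners I) k), inord (n + k.+1)) | k <- iota 0 q].
Definition arcs := source_arcs ++ path_arcs mu ++ term_arcs.
Definition arc_set : {set 'I_N * 'I_N} := [set a in arcs].

Lemma val_term k : k < q -> val (inord (n + k.+1) : 'I_N) = n + k.+1.
Proof. by move=> lt; rewrite /= inordK // ltnS leq_add2l. Qed.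

Lemma up_lt x : val (up x) < n.
Proof. by rewrite val_up; exact: ltn_ord. Qed.

Lemma sol_nth u i : i < p -> path_links (@vdp_edge I) (nth u (vdp_pairs I) i) (nth [::] mu i).
Proof.
case: solmu => + _; elim: (vdp_pairs I) mu i => //= st s IH [|m mu'] //= [|i] /andP[//] l.
exact: IH.
Qed.

Lemma size_sol : size mu = p.
Proof. by case: solmu; rewrite all2E => /andP[/eqP->]. Qed.

Lemma sol_disjoint i j x : i < p -> j < p ->
  x \in nth [::] mu i -> x \in nth [::] mu j -> i = j.
Proof.
wlog : i j / i < j.
  move=> H li lj xi xj; case: (ltngtP i j) => // lt; first exact: H.
  by symmetry; apply: H.
case: solmu => _ /(pairwiseP [::]) h lt li lj xi xj.
have := h i j; rewrite !inE size_sol => /(_ li lj lt)/hasPn/(_ _ xj)/negP.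
by case.
Qed.

(** The heads of the source arcs restore the first vertices that [behead] removes, so up to order
    the heads are all the path vertices, followed by the terminals. *)
Lemma uniq_arcs : uniq (unzip2 arcs).
Proof.
have -> : unzip2 arcs = map up (unzip1 (vdp_pairs I) ++ flatten (map behead mu)) ++
    [seq inord (n + k.+1) | k <- iota 0 q].
  rewrite /unzip2 /arcs !map_cat -!/(unzip2 _) unzip2_path_arcs catA; congr ((_ ++ _) ++ _).
    by rewrite /unzip2 -!map_comp.
  by rewrite /unzip2 -!map_comp.
rewrite cat_uniq (map_inj_uniq (@up_inj I)).
have -> : uniq (unzip1 (vdp_pairs I) ++ flatten (map behead mu)).
  have := sol_uniq solmu; rewrite (@perm_uniq _ _ (flatten mu)) //.
  case: solmu => + _; elim: (vdp_pairs I) mu => [|st s IH] [|[|x m] mu'] //=.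
  move=> /andP[/and4P[/eqP-> _ _ _] /IH h]; rewrite perm_cons.
  by rewrite perm_catCA perm_cat2l.
rewrite map_inj_in_uniq ?iota_uniq ?andbT /=.
  apply/hasPn => x /mapP[k]; rewrite mem_iota => /andP[_ lk] ->.
  apply/negP => /mapP[y _ e]; have := up_lt y; rewrite -e val_term //; lia.
move=> k k'; rewrite !mem_iota => /andP[_ lk] /andP[_ lk'] /(congr1 val).
by rewrite !val_term //; lia.
Qed.

Variant arc_spec : 'I_N * 'I_N -> Prop :=
| SourceArc i of i < p : arc_spec (r, inord (src I i))
| PathArc i b of i < p & b \in zip (nth [::] mu i) (behead (nth [::] mu i)) :
    arc_spec (up b.1, up b.2)
| TermArc k i of k < q & i < p & nth 0 (owners I) k = snk I i :
    arc_spec (inord (snk I i), inord (n + k.+1)).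

Lemma arcsP a : a \in arc_set -> arc_spec a.
Proof.
rewrite inE !mem_cat => /or3P[/mapP[st sI ->]|/path_arcsP[m mm [b bm ->]]|/mapP[k]].
- have -> : up st.1 = inord (src I (index st (vdp_pairs I))).
    by rewrite (src_nth st) ?index_mem // nth_index.
  by apply: SourceArc; rewrite index_mem.
- move: bm; rewrite -(nth_index [::] mm); apply: PathArc.
  by rewrite -size_sol index_mem.
- rewrite mem_iota => /andP[_ lk] ->; have [i li e] := owners_snk lk.
  by rewrite e; apply: TermArc e.
Qed.

Lemma source_arc i : i < p -> (r, inord (src I i)) \in arc_set.
Proof.
move=> li; rewrite inE !mem_cat; apply/or3P; constructor 1; apply/mapP.
exists (nth (pair0 instI) (vdp_pairs I) i); first exact: mem_nth.
by rewrite (src_nth (pair0 instI)).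
Qed.

Lemma path_arc i b : i < p -> b \in zip (nth [::] mu i) (behead (nth [::] mu i)) ->
  (up b.1, up b.2) \in arc_set.
Proof.
move=> li bm; rewrite inE !mem_cat; apply/or3P; constructor 2; apply/path_arcsP.
by exists (nth [::] mu i); [rewrite mem_nth ?size_sol|exists b].
Qed.

Lemma term_arc_set k : k < q -> (inord (nth 0 (owners I) k), inord (n + k.+1)) \in arc_set.
Proof.
move=> lk; rewrite inE !mem_cat; apply/or3P; constructor 3; apply/mapP.
by exists k; rewrite // mem_iota.
Qed.

Lemma path_vertex_connect i x : i < p -> x \in nth [::] mu i -> connect (arc_rel arc_set) r (up x).
Proof.
move=> li; have := sol_nth (pair0 instI) li; have := @path_arc i _ li.
case: (nth [::] mu i) => // y s arcs_in /andP[/eqP ey _] xs.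
apply: connect_trans (connect1 (source_arc li)) _.
rewrite (src_nth (pair0 instI) li) -ey -/(up y).
apply: (@path_connect _ _ _ (map up s)); last by rewrite -map_cons map_f.
rewrite path_map; elim: s y {ey xs} arcs_in => //= z s IH y h.
apply/andP; split; first by apply: (h (y, z)); rewrite inE eqxx.
by apply: IH => b bs; apply: h; rewrite inE bs orbT.
Qed.

Lemma snk_mem i : i < p -> exists2 x, x \in nth [::] mu i & inord (snk I i) = up x.
Proof.
move=> li; have := sol_nth (pair0 instI) li.
case: (nth [::] mu i) => // y s /and4P[_ /eqP l _ _].
by exists (last y s); rewrite ?mem_last // l (snk_nth (pair0 instI)).
Qed.

Lemma snk_connect i : i < p -> connect (arc_rel arc_set) r (inord (snk I i)).
Proof. by move=> li; have [x xm ->] := snk_mem li; exact: path_vertex_connect xm. Qed.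

Lemma arc_set_arb : is_arborescence r arc_set.
Proof.
have c2 a : a \in arc_set -> connect (arc_rel arc_set) r a.1 /\ connect (arc_rel arc_set) r a.2.
  move=> /[dup] aS /arcsP[i li|i b li /zip_behead_mem[b1 b2]|k i lk li e].
  - by split=> //; apply: connect1; exact: source_arc.
  - by split; exact: path_vertex_connect li _.
  - split; first exact: snk_connect.
    apply: connect_trans (snk_connect li) (connect1 _).
    by rewrite -e; exact: term_arc_set.
split.
- move=> a /arcsP[i li|i b li _|k i lk li e] /=; apply/eqP => /(congr1 val); rewrite (val_root I).
  + by rewrite val_inord ?(src_lt instI) //; have := src_lt instI li; lia.
  + by move=> e; have := up_lt b.2; rewrite e ltnn.
  + by rewrite val_term //; lia.
- move=> a b; rewrite !inE => aS bS e.
  by apply: (map_uniq_inj uniq_arcs).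
- move=> x; rewrite !inE => /orP[/orP[/eqP->//|]|] /imsetP[a /c2[] + + ->] //.
Qed.

(** Path [i] with the terminals of its sink. No arc leaves this set, so it contains the subtree of
    each of its vertices, and its [i.+1] terminals bound theirs. *)
Definition branch i : {set 'I_N} :=
  [set x : 'I_N | (x \in map up (nth [::] mu i)) ||
                  ((n < x) && (nth 0 (owners I) (x - n.+1) == snk I i))].

Lemma mem_branch_up i x : (up x \in branch i) = (x \in nth [::] mu i).
Proof.
rewrite inE (mem_map (@up_inj I)) [n < _](_ : _ = false) ?orbF //.
by have := up_lt x; rewrite /=; lia.
Qed.

Lemma branch_closed i a b : i < p -> arc_rel arc_set a b -> a \in branch i -> b \in branch i.
Proof.
move=> li; suff H c : c \in arc_set -> c.1 \in branch i -> c.2 \in branch i by exact: (H (a, b)).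
case/arcsP=> [j lj|j d lj /zip_behead_mem[b1 b2]|k j lk lj e] /=.
- rewrite inE (val_root I) ltnn orbF => /mapP[x _ /(congr1 val)].
  by rewrite (val_root I) => e; have := up_lt x; rewrite -e ltnn.
- by rewrite !mem_branch_up => b1'; rewrite (sol_disjoint li lj b1' b1).
- have [x xj ->] := snk_mem lj; rewrite mem_branch_up => xi.
  rewrite inE (val_term lk) [n < _](_ : _ = true); last by lia.
  by rewrite addnS subSS addKn e (sol_disjoint li lj xi xj) eqxx orbT.
Qed.

Lemma card_branch i a : i < p -> a \in branch i ->
  #|cst_term (reduction I) :&: subtree arc_set a| <= i.+1.
Proof.
move=> li aC; rewrite -(count_owners instI li) -(card_group I).
apply: subset_leq_card; apply/subsetP => x; rewrite !inE => /andP[lt c].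
rewrite lt /=; have := connect_closed (fun a b => @branch_closed i a b li) c aC.
rewrite inE lt => /orP[/mapP[y _ ey]|//].
by have := up_lt y; rewrite -ey => lt'; have := ltn_trans lt lt'; rewrite ltnn.
Qed.

Lemma card_term_subtree k : k < q ->
  #|cst_term (reduction I) :&: subtree arc_set (inord (n + k.+1))| <= 1.
Proof.
move=> lk; rewrite -(cards1 (inord (n + k.+1) : 'I_N)).
apply: subset_leq_card; apply/subsetP => x; rewrite !inE => /andP[_ c].
have [//|/eqP ne] := eqVneq x (inord (n + k.+1)).
have [z arc _] := connect_arcl c (not_eq_sym ne).
have : val (inord (n + k.+1) : 'I_N) <= n.
  have H c' : c' \in arc_set -> val c'.1 <= n; last exact: (H _ arc).
  case/arcsP=> [j _|j b _ _|k' j _ lj _].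
  - by rewrite (val_root I).
  - exact: ltnW (up_lt _).
  - by rewrite val_inord ?(snk_lt instI) // ltnW ?(snk_lt instI).
by rewrite val_term //; lia.
Qed.

Lemma arc_set_sol : cst_is_sol (I := reduction I) arc_set.
Proof.
split.
- move=> a /arcsP[i li|i b li bm|k i lk li e] /=.
  + by rewrite -!/(val _) (val_root I) val_inord ?(src_lt instI) // (ent_src instI).
  + by rewrite -!/(val _) (ent_edge instI (sol_edge solmu _ bm)) // mem_nth ?size_sol.
  + rewrite -!/(val _) val_inord ?(snk_lt instI) // val_term // -e.
    by rewrite (ent_term instI).
- exact: arc_set_arb.
- apply/subsetP => x; rewrite inE => lt.
  have lk : x - n.+1 < q by have := ltn_ord x; rewrite /=; lia.
  rewrite inE; apply/orP; right; apply/imsetP.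
  exists (inord (nth 0 (owners I) (x - n.+1)), inord (n + (x - n.+1).+1)).
    exact: term_arc_set.
  by rewrite /= -addSnnS subnKC // inord_val.
- move=> a /arcsP[i li|i b li bm|k i lk li e] /=.
  + rewrite -!/(val _) (val_root I) val_inord ?(src_lt instI) // (ent_src instI) //=.
    apply: card_branch => //.
    have := sol_nth (pair0 instI) li.
    case E: (nth [::] mu i) => [//|y s] /andP[/eqP ey _].
    by rewrite (src_nth (pair0 instI)) // -ey -[inord _]/(up y) mem_branch_up E inE eqxx.
  + rewrite -!/(val _) (ent_edge instI (sol_edge solmu _ bm)) ?mem_nth ?size_sol //=.
    (* Old edges have capacity [p], and [li] reads as [i.+1 <= p]. *)
    apply: leq_trans (card_branch li _) li.
    by rewrite mem_branch_up; case: (zip_behead_mem bm).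
  + rewrite -!/(val _) val_inord ?(snk_lt instI) // val_term // -e (ent_term instI) //=.
    exact: card_term_subtree.
Qed.

Lemma cost_arc_set : cst_cost (I := reduction I) arc_set = vdp_cost mu.
Proof.
rewrite -(cost_path_arcs instI solmu) /cst_cost.
rewrite (eq_bigl (mem arcs)); last by move=> a; rewrite inE.
rewrite -big_uniq /=; last exact: map_uniq uniq_arcs.
rewrite !big_cat /= [X in (X + _)%R]big1_seq ?add0r; last first.
  move=> a /mapP[st sI ->] /=; rewrite -!/(val _) (val_root I) val_up.
  have li : index st (vdp_pairs I) < p by rewrite index_mem.
  have := ent_src instI li; rewrite (src_nth st li) nth_index //= => ->.
  by [].
rewrite [X in (_ + X)%R]big1_seq ?addr0 // => a /mapP[k]; rewrite mem_iota => /andP[_ lk] -> /=.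
rewrite -!/(val _) val_inord ?(owner_lt instI) // val_term // (ent_term instI) //.
Qed.

End TreeOfPaths.

(** Discharges [old_into_last]: without an old edge, an arc into the last sink would have capacity 1
    and length [big_len I]. *)
Lemma big_arc_unused (directed : bool) (I : vdp_inst) (S : cst_sol (reduction I)) :
  vdp_is_inst directed I -> cst_is_sol S ->
  1 < size (vdp_pairs I) \/ (cst_cost S < big_len I)%R ->
  forall a, a \in S -> val a.2 = snk I (size (vdp_pairs I)).-1 -> val a.1 <= vdp_n I ->
  old I (val a.1) (val a.2) <> None.
Proof.
move=> instI solS h a aS ea le o.
have [c e] := arc_ent solS aS.
have ec : c = (big_len I, 1).
  by apply: (ent_into_last_snk instI (x := val a.1)); rewrite -?ea.
rewrite {c}ec in e; case: h => [gt1|]; last first.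
  rewrite ltNge => /negP; apply; rewrite /cst_cost (bigD1 a) //= e lerDl.
  apply: sumr_ge0 => b /andP[bS _]; have [c ec] := arc_ent solS bS.
  by rewrite /= ec; exact: ent_ge0 instI _ _ _ ec.
have lp := last_pair instI.
have [_ _ _ /(_ _ aS)] := solS; rewrite /= e /=; apply/negP; rewrite -ltnNge.
(* Pair [p.-1] owns [p.-1.+1 = p] terminals, all entered from the last sink, so more than one lies
   below the arc. *)
apply: (leq_trans gt1); rewrite -{1}(prednK (ltnW gt1)) -(count_owners instI lp) -(card_group I).
apply: subset_leq_card; apply/subsetP => x; rewrite !inE => /andP[lt /eqP ex].
rewrite lt /=; apply: connect1; rewrite /arc_rel.
by have := term_arc instI solS lt; rewrite ex -ea inord_val.
Qed.

Theorem theorem4p2 (directed : bool) :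
  poly_reducible
    (P := restrict (@feasible_if_single_pair directed))
    (Q := ML_CAP_STEINER_TREE directed)
    (fun (I : vdp_inst) (I' : cst_inst) =>
       let p := size (vdp_pairs I) in #|cst_term I'| = (p * p.+1)./2).
Proof.
have [cF [kF hF]] := polyf_runs_poly polyf_t_reduction.
have [cG [kG hG]] := polyf_runs_poly polyf_t_extract.
exists cF, cG, (maxn kF kG) => I [instI single].
have build (mu : vdp_sol I) : vdp_is_sol mu -> exists2 S : cst_sol (reduction I),
    cst_is_sol S & cst_cost S = vdp_cost mu.
  by move=> sol; exists (arc_set mu);
    [exact: (arc_set_sol instI sol)|exact: (cost_arc_set instI sol)].
exists (reduction I); split.
- exact: reduction_inst.
- exact: card_term.
- rewrite /= -(t_reductionE (pairs_gt0 instI)).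
  by apply: hF; exact: leq_maxl.
- split=> [[mu /build[S solS _]]|[S solS]]; first by exists S.
  (* With one pair, an arbitrary feasible tree may enter the sink by the long edge, so no path can
     be read off it; [single] gives feasibility instead. *)
  have [/single//|ne1] := eqVneq (size (vdp_pairs I)) 1.
  have gt1 : 1 < size (vdp_pairs I) by have := pairs_gt0 instI; lia.
  have [mu [sol _ _]] := extract_paths instI solS (big_arc_unused instI solS (or_introl gt1)).
  by exists mu.
move=> S [solS optS].
have h : 1 < size (vdp_pairs I) \/ (cst_cost S < big_len I)%R.
  have [/single[mu sol]|ne1] := eqVneq (size (vdp_pairs I)) 1; last first.
    by left; have := pairs_gt0 instI; lia.
  (* A tree built from any solution costs less than [big_len I], hence so does the optimal [S]. *)
  right; have [S' solS' eS'] := build mu sol.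
  by apply: le_lt_trans (optS _ solS') _; rewrite /= eS'; exact: (cost_lt_big instI sol).
have [mu [sol enc sub]] := extract_paths instI solS (big_arc_unused instI solS h).
exists mu.
  (* The cost of [mu] is at most that of [S], hence at most that of the tree [S'] built from [mu'],
     which equals the cost of [mu']. *)
  split=> // mu' /build[S' solS' eS'].
  have le := cost_extract instI solS sol sub.
  by apply: le_trans le _; rewrite /= -eS'; exact: optS.
rewrite /= enc; apply: hG; exact: leq_maxr.
Qed.
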